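(* Let $m,n\ge0$ be integers, $a\in\mathbb{C}$, $R\in\mathbb{C}[\mathcal{E}]\otimes Z(U(\mathfrak{gl}(m|n)))$, and let $\lambda$ be a weight of $\mathfrak{gl}(m|n)$ with $v_\lambda$ a highest weight vector of $L(\lambda)$. Let $r\in\mathbb{C}$ be the scalar by which $R$ acts on $\mathcal{F}_a\otimes L(\lambda)$ and let $$\widetilde\lambda=(a+r,\lambda_1+r,\dots,\lambda_m+r,\lambda_{\bar1}-r,\dots,\lambda_{\bar n}-r),$$ a weight of $\mathfrak{gl}(m+1|n)$. Then $\mathcal{F}_a\otimes L(\lambda)\cong L(\widetilde\lambda)$ as $\mathfrak{gl}(m+1|n)$-modules (via $\varphi_R$) if and only if $\mathcal{F}_a\otimes L(\lambda)$ is generated, as a $\mathfrak{gl}(m+1|n)$-module, by the highest weight vector $t_0^a\otimes v_\lambda$.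
   Context: Everything is over $\mathbb{C}$ and $\mathbb{Z}/2$-graded. Let $I=\{1,\dots,m,\bar 1,\dots,\bar n\}$ and $\hat I=\{0\}\cup I$, ordered by $0<1<\dots<m<\bar1<\dots<\bar n$, with parity $|i|=0$ for unbarred and $|i|=1$ for barred indices. $\mathfrak{gl}(m+1|n)$ has basis the elementary matrices $e_{ij}$ ($i,j\in\hat I$) of parity $|i|+|j|$, with supercommutator bracket; $\mathfrak{gl}(m|n)$ is the subalgebra spanned by $e_{ij}$, $i,j\in I$. Cartan subalgebras are the diagonal matrices, $\mathfrak{n}^+$ denotes strictly upper triangular matrices (span of $e_{ij}$ with $i<j$), and a weight $\lambda$ is written as the tuple of values $\lambda_i=\lambda(e_{ii})$ (indices in $I$ for $\mathfrak{gl}(m|n)$, in $\hat I$ for $\mathfrak{gl}(m+1|n)$). $L(\lambda)$ (resp. $L(\widetilde\lambda)$) is the simple $\mathfrak{gl}(m|n)$-module (resp. $\mathfrak{gl}(m+1|n)$-module) of the given highest weight with respect to $\mathfrak{n}^+$. $\mathcal{F}=\mathbb{C}[t_0^{\pm1},t_1,\dots,t_m]\otimes\Lambda_n$ with $\Lambda_n$ the exterior algebra on odd generators $t_{\bar 1},\dots,t_{\bar n}$ (supercommutative); $\partial_i=\partial/\partial t_i$ is the left superderivative. $\mathcal{D}'(m|n)$ is the superalgebra of operators on $\mathcal{F}$ generated by left multiplications by $t_i/t_0$ and by $t_0\partial_i$, $i\in\hat I$. $\mathcal{E}=\sum_{i\in\hat I}t_i\partial_i$. The center of $\mathcal{D}'(m|n)\otimes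 U(\mathfrak{gl}(m|n))$ is $\mathbb{C}[\mathcal{E}]\otimes Z(U(\mathfrak{gl}(m|n)))$. For $a\in\mathbb{C}$, $\mathcal{F}_a$ is the $\mathcal{D}'(m|n)$-module with basis the formal monomials $t_0^{a-k_1-\cdots-k_{\bar n}}t_1^{k_1}\cdots t_m^{k_m}t_{\bar1}^{k_{\bar1}}\cdots t_{\bar n}^{k_{\bar n}}$, $k_1,\dots,k_m\in\mathbb{Z}_{\ge0}$, $k_{\bar1},\dots,k_{\bar n}\in\{0,1\}$, with the evident action; $\mathcal{E}$ acts on it as the scalar $a$. Writing $R=\sum_i\mathcal{E}^i\otimes z_i$ with $z_i\in Z(U(\mathfrak{gl}(m|n)))$, $R$ acts on $\mathcal{F}_a\otimes L(\lambda)$ as the scalar $r=\sum_ia^i\chi_\lambda(z_i)$, where $z$ acts on $L(\lambda)$ as $\chi_\lambda(z)$. Tensor products use the usual sign rule. For $R$ central in $\mathcal{D}'(m|n)\otimes U(\mathfrak{gl}(m|n))$, $\varphi_R:U(\mathfrak{gl}(m+1|n))\to\mathcal{D}'(m|n)\otimes U(\mathfrak{gl}(m|n))$ is the superalgebra homomorphism with $e_{ab}\mapsto t_a\partial_b\otimes1+1\otimes e_{ab}+\delta_{ab}(-1)^{|a||b|}R$, $e_{a0}\mapsto t_a\partial_0\otimes1-\sum_{j\in I}(-1)^{|a||j|}\frac{t_j}{t_0}\otimes e_{aj}$, $e_{0b}\mapsto t_0\partial_b\otimes1$, $e_{00}\mapsto t_0\partial_0\otimes1+R$ for $a,b\in I$.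 *)

(* Defs.v *)
From HB Require Import structures.
From mathcomp Require Import all_boot all_order all_algebra.
From mathcomp Require Import finmap.
From mathcomp Require Import boolp reals.
From mathcomp.real_closed Require Export complex.
From mathcomp.multinomials Require Export monalg.

Set Implicit Arguments.
Unset Strict Implicit.
Unset Printing Implicit Defensive.

Import GRing.Theory.
Local Open Scope ring_scope.
Local Open Scope quotient_scope.

(* gl(p|q) is indexed by 'I_(p + q): the first p indices are the unbarred
   (even) ones, the last q the barred (odd) ones, in the order of 'I_(p + q).
   The index set of gl(m.+1|n) is convertible to 'I_(m + n).+1: the index 0 is
   ord0 and an index i of gl(m|n) becomes lift ord0 i. *)
Definition ipar (p q : nat) (i : 'I_(p + q)) : bool := (p <= i)%N.

Definition epar (p q : nat) (i j : 'I_(p + q)) : bool :=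
  ipar i (+) ipar j.

Notation free_gl K p q :=
  {malg K[{fmonom ('I_(p + q) * 'I_(p + q))%type}]}.

Section Enveloping.

Variables (K : fieldType) (p q : nat).

Local Notation free_gl := (free_gl K p q).

Definition free_e (i j : 'I_(p + q)) : free_gl := << fmu (i, j) >>.

(* [e_ij, e_kl] = e_ij e_kl - (-1)^(|e_ij||e_kl|) e_kl e_ij
                = delta_jk e_il - (-1)^(|e_ij||e_kl|) delta_il e_kj *)
Definition gl_rel (i j k l : 'I_(p + q)) : free_gl :=
  let s : K := (-1) ^+ (epar i j && epar k l) in
  free_e i j * free_e k l - s *: (free_e k l * free_e i j)
  - ((j == k)%:R *: free_e i l - (s * (i == l)%:R) *: free_e k j).

Inductive in_gl_ideal : free_gl -> Prop :=
| gl_ideal_rel i j k l : in_gl_ideal (gl_rel i j k l)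
| gl_ideal0 : in_gl_ideal 0
| gl_idealB x y : in_gl_ideal x -> in_gl_ideal y -> in_gl_ideal (x - y)
| gl_idealMl x y : in_gl_ideal y -> in_gl_ideal (x * y)
| gl_idealMr x y : in_gl_ideal x -> in_gl_ideal (x * y).

Definition gl_ideal (x : free_gl) : bool := `[< in_gl_ideal x >].

Fact gl_ideal_zmod_closed : zmod_closed gl_ideal.
Proof.
split=> [|x y]; first exact/asboolP/gl_ideal0.
by move=> /asboolP xI /asboolP yI; apply/asboolP/gl_idealB.
Qed.

HB.instance Definition _ :=
  GRing.isZmodClosed.Build free_gl gl_ideal gl_ideal_zmod_closed.

Let gl_idealZ : zmodClosed free_gl :=
  GRing.ZmodClosed.clone free_gl gl_ideal _.

Definition Ugl : Type := Quotient.quot gl_idealZ.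

HB.instance Definition _ := GRing.Zmodule.on Ugl.
HB.instance Definition _ := EqQuotient.on Ugl.

Definition Uproj (x : free_gl) : Ugl := \pi x.

Lemma UprojK (u : Ugl) : Uproj (repr u) = u.
Proof. exact: reprK. Qed.

Lemma Uproj_eq (x y : free_gl) : Uproj x = Uproj y <-> in_gl_ideal (x - y).
Proof.
rewrite /Uproj; split=> [xy|/asboolP xy].
  by apply/asboolP; have := Quotient.idealrBE gl_idealZ x y; rewrite xy eqxx.
by apply/eqP; rewrite -(Quotient.idealrBE gl_idealZ).
Qed.

Definition Umul (u v : Ugl) : Ugl := Uproj (repr u * repr v).

Lemma UprojM x y : Uproj (x * y) = Umul (Uproj x) (Uproj y).
Proof.
have rI z : in_gl_ideal (z - repr (Uproj z)).
  by apply/Uproj_eq; rewrite UprojK.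
apply/Uproj_eq.
have -> : x * y - repr (Uproj x) * repr (Uproj y) =
  x * (y - repr (Uproj y)) - (0 - (x - repr (Uproj x)) * repr (Uproj y)).
  by rewrite sub0r opprK mulrBr mulrBl addrA subrK.
apply: gl_idealB; first exact/gl_idealMl/rI.
by apply: gl_idealB; [apply: gl_ideal0|exact/gl_idealMr/rI].
Qed.

Lemma UprojD x y : Uproj (x + y) = Uproj x + Uproj y.
Proof. by rewrite /Uproj !piE. Qed.

Fact UmulA : associative Umul.
Proof.
by move=> x y z; rewrite -[x]UprojK -[y]UprojK -[z]UprojK -!UprojM mulrA.
Qed.

Fact Umul1 : left_id (Uproj 1) Umul.
Proof. by move=> x; rewrite -[x]UprojK -UprojM mul1r. Qed.

Fact Umulr1 : right_id (Uproj 1) Umul.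
Proof. by move=> x; rewrite -[x]UprojK -UprojM mulr1. Qed.

Fact UmulDl : left_distributive Umul +%R.
Proof.
move=> x y z; rewrite -[x]UprojK -[y]UprojK -[z]UprojK.
by rewrite -UprojD -!UprojM mulrDl UprojD.
Qed.

Fact UmulDr : right_distributive Umul +%R.
Proof.
move=> x y z; rewrite -[x]UprojK -[y]UprojK -[z]UprojK.
by rewrite -UprojD -!UprojM mulrDr UprojD.
Qed.

Fact Uone_neq0 : Uproj 1 != 0.
Proof.
have [aug [augB augZ augM aug1 aug_e]] : exists aug : free_gl -> K,
    [/\ forall x y, aug (x - y) = aug x - aug y,
        forall c x, aug (c *: x) = c * aug x,
        forall x y, aug (x * y) = aug x * aug y,
        aug 1 = 1 & forall i j, aug (free_e i j) = 0].
  pose aug := @mcoeff {fmonom ('I_(p + q) * 'I_(p + q))%type} K (@mone _).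
  have [augM aug1] : multiplicative aug by apply: mcoeff1g_is_multiplicative.
  exists aug; split=> // [x y|c x|i j]; first exact: mcoeffB.
    exact: mcoeffZ.
  rewrite /aug /free_e mcoeffU1; case: eqP => // /(congr1 (@fdeg _)).
  by rewrite fdegU fdeg1.
have lin (V : lmodType K) (f : V -> K) :
    (forall x y, f (x - y) = f x - f y) -> (forall c x, f (c *: x) = c * f x) ->
    forall s t1 t2 x y z w,
    f (x - s *: y - (t1 *: z - t2 *: w))
    = f x - s * f y - (t1 * f z - t2 * f w).
  by move=> fB fZ s t1 t2 x y z w; rewrite !fB !fZ.
have aug0 x : in_gl_ideal x -> aug x = 0.
  elim=> {x} [i j k l||x y _ IHx _ IHy|x y _ IHy|x y _ IHx].
  - apply: etrans (lin _ _ augB augZ _ _ _ _ _ _ _) _.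
    by rewrite !augM !aug_e !(mulr0, subr0).
  - by rewrite -[0](subrr 0) augB subrr.
  - by rewrite augB IHx IHy subr0.
  - by rewrite augM IHy mulr0.
  - by rewrite augM IHx mul0r.
apply/eqP => U1.
have /aug0 : in_gl_ideal (1 - 0) by apply/Uproj_eq; rewrite U1 /Uproj !piE.
by rewrite subr0 aug1 => /eqP; rewrite oner_eq0.
Qed.

HB.instance Definition _ := GRing.Zmodule_isNzRing.Build Ugl
  UmulA Umul1 Umulr1 UmulDl UmulDr Uone_neq0.

(* The plain center is also the supercenter: in both cases a central element
   commutes with the Cartan subalgebra, so it has weight 0 and is even. *)
Definition in_Zgl (z : Ugl) : Prop := forall u : Ugl, z * u = u * z.

End Enveloping.

(* A Z/2-graded space with operators indexed like the basis e_ij of gl(p|q);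
   it is a gl(p|q)-module when is_glmod holds. *)
Record glrep (K : fieldType) (p q : nat) := GLRep {
  glspace :> lmodType K;
  glhom : bool -> glspace -> Prop;
  glact : 'I_(p + q) -> 'I_(p + q) -> glspace -> glspace
}.

Record is_glmod (K : fieldType) (p q : nat) (V : glrep K p q) : Prop := {
  glmod_linear : forall i j, linear (@glact _ _ _ V i j);
  glmod_hom0 : forall b, @glhom _ _ _ V b 0;
  glmod_homP : forall b (c : K) (x y : V),
    glhom b x -> glhom b y -> glhom b (c *: x + y);
  glmod_homD : forall x : V, exists x0 x1 : V,
    [/\ glhom false x0, glhom true x1 & x = x0 + x1];
  glmod_homI : forall x : V, glhom false x -> glhom true x -> x = 0;
  glmod_act_hom : forall i j b (x : V),
    glhom b x -> glhom (epar i j (+) b) (glact i j x);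
  glmod_bracket : forall i j k l (x : V),
    let s : K := (-1) ^+ (epar i j && epar k l) in
    glact i j (glact k l x) - s *: glact k l (glact i j x)
    = (j == k)%:R *: glact i l x - (s * (i == l)%:R) *: glact k j x
}.

Section Modules.

Variables (K : fieldType) (p q : nat).
Implicit Types V W : glrep K p q.

Definition is_submod V (N : V -> Prop) : Prop :=
  [/\ N 0,
      forall (c : K) x y, N x -> N y -> N (c *: x + y),
      forall x0 x1, glhom false x0 -> glhom true x1 ->
        N (x0 + x1) -> N x0 /\ N x1 &
      forall i j x, N x -> N (glact i j x)].

Definition is_simple V : Prop :=
  (exists x : V, x <> 0) /\
  forall N : V -> Prop, is_submod N ->
    (forall x, N x -> x = 0) \/ (forall x, N x).

Definition generated_by V (v : V) : Prop :=
  forall N : V -> Prop, is_submod N -> N v -> forall x, N x.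

Definition is_hwv V (lam : 'I_(p + q) -> K) (v : V) : Prop :=
  [/\ v <> 0,
      forall i j : 'I_(p + q), (i < j)%N -> glact i j v = 0 &
      forall i, glact i i v = lam i *: v].

(* L(lam) is determined by lam up to isomorphism and parity shift: V is the
   copy of L(lam) whose highest weight vector v has parity b. *)
Definition is_L (lam : 'I_(p + q) -> K) (b : bool) V (v : V) : Prop :=
  [/\ is_glmod V, is_simple V, is_hwv lam v & glhom b v].

Definition gl_iso V W : Prop :=
  exists f : {linear V -> W},
    [/\ bijective f,
        forall b x, glhom b x -> glhom b (f x) &
        forall i j x, f (glact i j x) = glact i j (f x)].

Definition word_act V (w : {fmonom ('I_(p + q) * 'I_(p + q))%type}) (x : V) :
    V := foldr (fun e y => glact e.1 e.2 y) x w.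

Definition free_act V (u : free_gl K p q) (x : V) : V :=
  \sum_(w <- msupp u) u@_w *: word_act w x.

(* Independent of the chosen representative when V is a module: U_act_proj. *)
Definition U_act V (u : Ugl K p q) (x : V) : V := free_act (repr u) x.

End Modules.

Section UActProj.

Variables (K : fieldType) (p q : nat) (V : glrep K p q).
Hypothesis V_mod : is_glmod V.

Local Notation word := {fmonom ('I_(p + q) * 'I_(p + q))%type}.

Fact word_act_linear (w : word) : linear (@word_act K p q V w).
Proof.
rewrite /word_act => c x y.
elim: (fmonom_val w) => //= e s ->; exact: glmod_linear.
Qed.

Fact free_actEw (d : {fset word}) (u : {malg K[word]}) (x : V) :
  (msupp u `<=` d)%fset ->
  free_act u x = \sum_(w <- d) u@_w *: word_act w x.
Proof.
move=> ud; rewrite /free_act (big_fset_incl _ ud) //= => w _ wu.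
by rewrite mcoeff_outdom ?scale0r.
Qed.

Fact free_actD (u1 u2 : {malg K[word]}) (x : V) :
  free_act (u1 + u2) x = free_act u1 x + free_act u2 x.
Proof.
pose d := (msupp u1 `|` msupp u2)%fset.
rewrite (free_actEw _ (msuppD_le u1 u2)) (@free_actEw d u1) ?fsubsetUl //.
rewrite (@free_actEw d u2) ?fsubsetUr // -big_split.
by apply: eq_bigr => w _; rewrite mcoeffD scalerDl.
Qed.

Fact free_actZ c (u : {malg K[word]}) (x : V) :
  free_act (c *: u) x = c *: free_act u x.
Proof.
rewrite (free_actEw _ (msuppZ_le c u)) scaler_sumr.
by apply: eq_bigr => w _; rewrite mcoeffZ scalerA.
Qed.

Fact free_actU c (w : word) (x : V) :
  free_act << c *g w >> x = c *: word_act w x.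
Proof.
by rewrite (free_actEw _ (msuppU_le (k := w))) big_seq_fset1 mcoeffUU.
Qed.

Fact free_act0 (x : V) : free_act (0 : {malg K[word]}) x = 0.
Proof. by rewrite /free_act msupp0 big_seq_fset0. Qed.

Fact free_act_sum (I : Type) (s : seq I) (F : I -> {malg K[word]}) (x : V) :
  free_act (\sum_(i <- s) F i) x = \sum_(i <- s) free_act (F i) x.
Proof.
elim: s => [|i s IH]; last by rewrite !big_cons free_actD IH.
by rewrite !big_nil free_act0.
Qed.

Fact word_act_sum (w : word) (I : Type) (s : seq I) (F : I -> V) (c : I -> K) :
  word_act w (\sum_(i <- s) c i *: F i)
  = \sum_(i <- s) c i *: word_act w (F i).
Proof.
elim: s => [|i s IH]; last by rewrite !big_cons word_act_linear IH.
rewrite !big_nil; have := word_act_linear w (-1) 0 0.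
by rewrite scaler0 addr0 scaleN1r addNr.
Qed.

Fact free_actM (u1 u2 : {malg K[word]}) (x : V) :
  free_act (u1 * u2) x = free_act u1 (free_act u2 x).
Proof.
rewrite malgME free_act_sum; apply: eq_bigr => w1 _.
rewrite free_act_sum word_act_sum scaler_sumr; apply: eq_bigr => w2 _.
rewrite free_actU scalerA; congr (_ *: _).
by rewrite /word_act fmM foldr_cat.
Qed.

Fact free_act_e i j (x : V) : free_act (free_e K i j) x = glact i j x.
Proof. by rewrite /free_e free_actU scale1r /word_act fmU. Qed.

Fact free_act_ideal (u : free_gl K p q) (x : V) :
  in_gl_ideal u -> free_act u x = 0.
Proof.
have actN (y : {malg K[word]}) (z : V) : free_act (- y) z = - free_act y z.
  by rewrite -(scaleN1r y) free_actZ scaleN1r.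
have act0 (y : {malg K[word]}) : free_act y (0 : V) = 0.
  rewrite /free_act big1 // => w _.
  have := word_act_sum w (Nil unit) (fun=> 0) (fun=> 0).
  by rewrite !big_nil => ->; rewrite scaler0.
have actB (y z : {malg K[word]}) (t : V) :
    free_act (y - z) t = free_act y t - free_act z t.
  by rewrite free_actD actN.
have lin (U : lmodType K) (f : U -> V) :
    (forall y z, f (y - z) = f y - f z) ->
    (forall c y, f (c *: y) = c *: f y) ->
    forall s t1 t2 y z t r,
    f (y - s *: z - (t1 *: t - t2 *: r))
    = f y - s *: f z - (t1 *: f t - t2 *: f r).
  by move=> fB fZ s t1 t2 y z t r; rewrite !fB !fZ.
move=> uI; elim: uI x => {u} [i j k l||y z _ IHy _ IHz|y z _ IHz|y z _ IHy] x.
- pose f (y : {malg K[word]}) : V := free_act y x.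
  apply: etrans (@lin _ f (fun y z => actB y z x) (fun c y => free_actZ c y x)
    _ _ _ _ _ _ _) _.
  have fe i' j' : f (free_e K i' j') = glact i' j' x by exact: free_act_e.
  have fee i' j' k' l' : f (free_e K i' j' * free_e K k' l')
      = glact i' j' (glact k' l' x).
    by apply: etrans (free_actM _ _ _) _; rewrite 2!free_act_e.
  apply: etrans (_ : _ = glact i j (glact k l x) - _ *: glact k l (glact i j x)
    - (_ *: glact i l x - _ *: glact k j x)) _.
    by congr (_ - _ *: _ - (_ *: _ - _ *: _)); [exact: fee|exact: fee|
      exact: fe|exact: fe].
  by rewrite (glmod_bracket V_mod) subrr.
- exact: free_act0.
- by apply: etrans (actB _ _ _) _; rewrite IHy IHz subr0.
- by apply: etrans (free_actM _ _ _) _; rewrite IHz act0.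
- by apply: etrans (free_actM _ _ _) _; rewrite IHy.
Qed.

Lemma U_act_proj (u : free_gl K p q) (x : V) :
  U_act (Uproj u) x = free_act u x.
Proof.
have : in_gl_ideal (repr (Uproj u) - u) by apply/Uproj_eq; rewrite UprojK.
move=> /(free_act_ideal x) du; rewrite /U_act -[LHS]subr0 -[X in _ - X]du.
have := free_actD (repr (Uproj u) - u) u x.
by rewrite subrK => ->; rewrite du add0r subr0.
Qed.

End UActProj.

Section TensorModule.

Variables (K : fieldType) (m n : nat).

(* k is the exponent (k_1, .., k_m, k_bar1, .., k_barn) of the monomial
   t_0^(a - k_1 - .. - k_barn) t_1^(k_1) .. t_barn^(k_barn) of F_a. *)
Definition is_expo (k : {ffun 'I_(m + n) -> nat}) : bool :=
  [forall i : 'I_(m + n), ipar i ==> (k i <= 1)%N].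

Definition expo : Type := {k : {ffun 'I_(m + n) -> nat} | is_expo k}.

HB.instance Definition _ := Choice.on expo.

Fact is_expo0 : is_expo [ffun=> 0%N].
Proof. by apply/forallP => i; rewrite ffunE implybT. Qed.

Definition expo0 : expo := exist _ [ffun=> 0%N] is_expo0.

Definition expo_sum (k : expo) : nat := (\sum_i val k i)%N.

Definition expo_par (k : expo) : bool := odd (\sum_(i | ipar i) val k i)%N.

(* the sign for moving t_i, or its derivative, past the t_j with j < i *)
Definition koszul (i : 'I_(m + n)) (k : expo) : K :=
  (-1) ^+ (ipar i * \sum_(j | ipar j && (j < i)%N) val k j).

Definition expo_up (i : 'I_(m + n)) (k : expo) : option expo :=
  insub [ffun j => (val k j + (j == i))%N].

Definition expo_down (i : 'I_(m + n)) (k : expo) : option expo :=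
  insub [ffun j => (val k j - (j == i))%N].

(* F_a, as a vector space: it depends on a only through the action *)
Definition Fa : Type := {malg K[expo]}.

HB.instance Definition _ := GRing.Lmodule.on Fa.

Definition mono (k : expo) : Fa := << k >>.

Definition extend_lin (g : expo -> Fa) (f : Fa) : Fa :=
  \sum_(k <- msupp f) f@_k *: g k.

(* left multiplication by t_i / t_0 *)
Definition t_over_t0 (i : 'I_(m + n).+1) : Fa -> Fa :=
  extend_lin (fun k =>
    if unlift ord0 i is Some j then
      if expo_up j k is Some k' then koszul j k *: mono k' else 0
    else mono k).

(* t_0 d/dt_i *)
Definition t0_d (a : K) (i : 'I_(m + n).+1) : Fa -> Fa :=
  extend_lin (fun k =>
    if unlift ord0 i is Some j then
      if expo_down j k is Some k' then
        (koszul j k * (val k j)%:R) *: mono k' else 0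
    else (a - (expo_sum k)%:R) *: mono k).

(* t_i d/dt_j = (t_i / t_0) (t_0 d/dt_j) *)
Definition t_d (a : K) (i j : 'I_(m + n).+1) : Fa -> Fa :=
  t_over_t0 i \o t0_d a j.

Definition euler (a : K) (f : Fa) : Fa := \sum_i t_d a i i f.

Variable (L : glrep K m n).

(* F_a (x) L is realised as the direct sum of the t^k (x) L, i.e. as the
   finitely supported functions from exponents to L. *)
Definition FaL : Type := {malg L[expo]}.

HB.instance Definition _ := GRing.Zmodule.on FaL.

Definition FaL_scale (c : K) (x : FaL) : FaL :=
  [malg k in msupp x => c *: x@_k].

Fact FaL_scaleE c (x : FaL) k : mcoeff k (FaL_scale c x) = c *: mcoeff k x.
Proof. by rewrite mcoeffE; case: msuppP; rewrite ?scaler0. Qed.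

Fact FaL_scaleA c1 c2 (x : FaL) :
  FaL_scale c1 (FaL_scale c2 x) = FaL_scale (c1 * c2) x.
Proof. by apply/malgP => k; rewrite !FaL_scaleE scalerA. Qed.

Fact FaL_scale1 : left_id 1 FaL_scale.
Proof. by move=> x; apply/malgP => k; rewrite FaL_scaleE scale1r. Qed.

Fact FaL_scaleDr : right_distributive FaL_scale +%R.
Proof.
move=> c x y; apply/malgP => k.
by rewrite mcoeffD !FaL_scaleE mcoeffD scalerDr.
Qed.

Fact FaL_scaleDl (x : FaL) :
  {morph FaL_scale^~ x : c1 c2 / c1 + c2 >-> c1 + c2}.
Proof.
move=> c1 c2; apply/malgP => k.
by rewrite mcoeffD !FaL_scaleE scalerDl.
Qed.

HB.instance Definition _ := GRing.Zmodule_isLmodule.Build K FaL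
  FaL_scaleA FaL_scale1 FaL_scaleDr FaL_scaleDl.

(* f (x) v *)
Definition pure (f : Fa) (v : L) : FaL :=
  \sum_(k <- msupp f) << f@_k *: v *g k >>.

(* (d (x) u) (f (x) v) = (-1)^(|u||f|) d f (x) u v, for u of parity b *)
Definition tens (d : Fa -> Fa) (b : bool) (u : L -> L) (x : FaL) : FaL :=
  \sum_(k <- msupp x)
    pure (d (mono k)) ((-1) ^+ (b && expo_par k) *: u (x@_k)).

(* An element \sum_i E^i (x) R`_i of C[E] (x) U(gl(m|n)) is encoded as the
   polynomial R in E. No sign occurs when the R`_i are central, hence even. *)
Definition R_act (a : K) (R : {poly Ugl K m n}) (x : FaL) : FaL :=
  \sum_(i < size R) tens (iter i (euler a)) false (U_act R`_i) x.

(* The action of phi_R(e_ij) for i, j in {0} + I. *)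
Definition phi_act (a : K) (R : {poly Ugl K m n}) (i j : 'I_(m + n).+1)
    (x : FaL) : FaL :=
  match unlift ord0 i, unlift ord0 j with
  | Some s, Some t =>
      tens (t_d a i j) false id x + tens id (epar s t) (glact s t) x
      + (if s == t then (-1) ^+ (ipar s && ipar t) *: R_act a R x else 0)
  | Some s, None =>
      tens (t_d a i ord0) false id x
      - \sum_(l < m + n) (-1) ^+ (ipar s && ipar l) *:
          tens (t_over_t0 (lift ord0 l)) (epar s l) (glact s l) x
  | None, Some _ => tens (t0_d a j) false id x
  | None, None => tens (t0_d a ord0) false id x + R_act a R x
  end.

Definition FaL_hom (b : bool) (x : FaL) : Prop :=
  forall k, glhom (expo_par k (+) b) (mcoeff k x).

Definition FaL_rep (a : K) (R : {poly Ugl K m n}) : glrep K m.+1 n :=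
  @GLRep K m.+1 n FaL FaL_hom (phi_act a R).

(* t_0^a (x) v *)
Definition top_vector (v : L) : FaL := pure (mono expo0) v.

Definition lam_tilde (a r : K) (lam : 'I_(m + n) -> K) (i : 'I_(m.+1 + n)) : K :=
  if unlift ord0 i is Some j then
    if ipar j then lam j - r else lam j + r
  else a + r.

End TensorModule.

(* Main.v *)
From HB Require Import structures.
Require Import Defs.
From mathcomp Require Import all_boot all_order all_algebra.
From mathcomp Require Import finmap.
From mathcomp Require Import boolp reals.
From mathcomp Require Import ring zify.

(* If F_a (x) L is isomorphic to the simple module L(lam~), it is generated by
   any of its nonzero vectors.  Conversely, the elements e_0b act on F_a (x) L
   as the derivations t_0 d/dt_b, so a nonzero submodule N contains some
   t_0^a (x) u with u nonzero; on t_0^a (x) L the subalgebra gl(m|n) acts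
   through L up to the scalars +-r, so by simplicity of L the submodule N
   contains t_0^a (x) v, hence is everything when this vector generates.  Two
   simple modules with the same highest weight are isomorphic: the submodule of
   their direct sum generated by the pair of highest weight vectors is spanned
   by words in the lowering operators, so its top weight space is a line and it
   is the graph of an isomorphism. *)

Set Implicit Arguments.
Unset Strict Implicit.
Unset Printing Implicit Defensive.

Import GRing.Theory Num.Theory.
Local Open Scope ring_scope.

(** * Linear identities *)

(** Since [R] acts as the scalar [r], it contributes to the action only the character [r] times the
    supertrace, which vanishes on supercommutators; so the bracket relations need checking only for
    [R = 0], where they reduce to commutation relations between a few families of operators.

    Modules here are arbitrary graded spaces with operators satisfying the bracket relations, so no
    weight decomposition is at hand. A single Cartan element, [height], replaces it: lowering
    operators increase its eigenvalue by positive integers, so some polynomial in it kills a given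
    combination of nonempty lowering words, yet acts as a nonzero scalar on the eigenspace of the
    highest weight vector, the characteristic being zero. This also avoids a PBW basis.

    Characteristic zero enters once more in finding [t_0^a (x) u]: a vector killed by all
    derivations has no monomial of positive degree. *)

Section LinearExpr.

Variables (K : pzRingType) (V : lmodType K).

Inductive lexpr :=
| LVar of nat
| LZero
| LAdd of lexpr & lexpr
| LOpp of lexpr
| LScale of K & lexpr.

Fixpoint leval (env : seq V) (e : lexpr) : V :=
  match e with
  | LVar i => nth 0 env i
  | LZero => 0
  | LAdd e1 e2 => leval env e1 + leval env e2
  | LOpp e1 => - leval env e1
  | LScale c e1 => c *: leval env e1
  end.

Fixpoint lscalar (rho : nat -> K) (e : lexpr) : K :=
  match e with
  | LVar i => rho i
  | LZero => 0
  | LAdd e1 e2 => lscalar rho e1 + lscalar rho e2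
  | LOpp e1 => - lscalar rho e1
  | LScale c e1 => c * lscalar rho e1
  end.

(** The indicator assignment of [i] reads off the coefficient of the [i]-th atom, so scalar
    evaluations determine the value in [V]. *)
Lemma levalE env e :
  leval env e = \sum_(i < size env) lscalar (fun j => (j == i)%:R) e *: env`_i.
Proof.
elim: e => [j||e1 IH1 e2 IH2|e IH|c e IH] /=.
- have [jlt|jge] := ltnP j (size env).
    rewrite (bigD1 (Ordinal jlt)) //= eqxx scale1r big1 ?addr0 // => i.
    by rewrite -val_eqE /= eq_sym => /negPf ->; rewrite scale0r.
  rewrite nth_default // big1 // => i _.
  by rewrite gtn_eqF ?scale0r // (leq_trans (ltn_ord i)).
- by rewrite big1 // => i _; rewrite scale0r.
- by rewrite IH1 IH2 -big_split; apply: eq_bigr => i _; rewrite scalerDl.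
- by rewrite IH -sumrN; apply: eq_bigr => i _; rewrite scaleNr.
- by rewrite IH scaler_sumr; apply: eq_bigr => i _; rewrite scalerA.
Qed.

(* A formal linear identity holds in V as soon as it holds for scalars, where
   it can be decided by [ring]. *)
Lemma leval_eq env e1 e2 :
  (forall rho, lscalar rho e1 = lscalar rho e2) -> leval env e1 = leval env e2.
Proof. by move=> H; rewrite !levalE; apply: eq_bigr => i _; rewrite H. Qed.

End LinearExpr.

Ltac lindex x env :=
  lazymatch env with
  | x :: _ => constr:(0%N)
  | _ :: ?env' => let i := lindex x env' in constr:(S i)
  end.

Ltac lextend x env :=
  match env with
  | context [x :: _] => env
  | _ => constr:(x :: env)
  end.

Ltac latoms t env :=
  lazymatch t with
  | (?a + ?b)%R => let env := latoms a env in latoms b env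
  | (- ?a)%R => latoms a env
  | (_ *: ?a)%R => latoms a env
  | 0%R => env
  | _ => lextend t env
  end.

Ltac lreify K t env :=
  lazymatch t with
  | (?a + ?b)%R =>
      let a' := lreify K a env in let b' := lreify K b env in
      constr:(@LAdd K a' b')
  | (- ?a)%R => let a' := lreify K a env in constr:(@LOpp K a')
  | (?c *: ?a)%R => let a' := lreify K a env in constr:(@LScale K c a')
  | 0%R => constr:(@LZero K)
  | _ => let i := lindex t env in constr:(@LVar K i)
  end.

(** Each atom becomes an unknown scalar; the coefficients of [*:] are kept as terms of [K] and reach
    [ring] unchanged. *)
Ltac lmod_ring K V :=
  lazymatch goal with
  | |- @eq _ ?a ?b =>
      let env := constr:(@nil V) in
      let env := latoms a env in
      let env := latoms b env in
      let a' := lreify K a env in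
      let b' := lreify K b env in
      apply: (@leval_eq K V env a' b');
      let rho := fresh "rho" in intro rho; cbn [lscalar]; ring
  end.

(** * Highest weight modules *)

Section Basics.

Variables (K : numFieldType) (p q : nat) (V : glrep K p q).
Hypothesis V_mod : is_glmod V.

Lemma glactP i j c (x y : V) :
  glact i j (c *: x + y) = c *: glact i j x + glact i j y.
Proof. exact: (glmod_linear V_mod). Qed.

Lemma glact0 i j : glact i j (0 : V) = 0.
Proof.
by have := glactP i j (-1) 0 0; rewrite scaleN1r oppr0 addr0 scaleN1r addNr.
Qed.

Lemma glactD i j (x y : V) : glact i j (x + y) = glact i j x + glact i j y.
Proof. by have := glactP i j 1 x y; rewrite !scale1r. Qed.

Lemma glactZ i j c (x : V) : glact i j (c *: x) = c *: glact i j x.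
Proof. by have := glactP i j c x 0; rewrite glact0 !addr0. Qed.

Lemma glhomD b (x y : V) : glhom b x -> glhom b y -> glhom b (x + y).
Proof.
by move=> xb yb; have := glmod_homP V_mod 1 xb yb; rewrite scale1r.
Qed.

Lemma glhomZ b c (x : V) : glhom b x -> glhom b (c *: x).
Proof.
move=> xb; have := glmod_homP V_mod c xb (glmod_hom0 V_mod b).
by rewrite addr0.
Qed.

Lemma glhom_unique (x0 x1 y0 y1 : V) :
  glhom false x0 -> glhom true x1 -> glhom false y0 -> glhom true y1 ->
  x0 + x1 = y0 + y1 -> x0 = y0 /\ x1 = y1.
Proof.
move=> x0h x1h y0h y1h E.
have E' : x0 - y0 = y1 - x1.
  by apply/eqP; rewrite subr_eq addrAC [y1 + y0]addrC -E addrK.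
have d0 : x0 - y0 = 0.
  apply: (glmod_homI V_mod); first by rewrite -scaleN1r; apply/glhomD/glhomZ.
  by rewrite E' -scaleN1r; apply/glhomD/glhomZ.
split; first exact/eqP/(etrans (esym (subr_eq0 _ _)))/eqP.
by apply/esym/eqP; rewrite -subr_eq0 -E' d0.
Qed.

(* e_ij has weight i - j for this element, so that the lowering operators
   (j < i) are those which increase its eigenvalues. *)
Definition height (x : V) : V := \sum_(i < p + q) i%:R *: glact i i x.

Lemma heightP c x y : height (c *: x + y) = c *: height x + height y.
Proof.
rewrite /height scaler_sumr -big_split; apply: eq_bigr => i _ /=.
by rewrite glactP scalerDr !scalerA mulrC.
Qed.

Lemma height_act i j x :
  height (glact i j x) = glact i j (height x) + (i%:R - j%:R) *: glact i j x.
Proof.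
have act_sum (I : finType) (F : I -> V) :
    glact i j (\sum_k F k) = \sum_k glact i j (F k).
  by apply: (big_morph (glact i j)) => [y z|]; rewrite ?glactD ?glact0.
have commE k : glact k k (glact i j x) = glact i j (glact k k x)
    + ((k == i)%:R - (k == j)%:R) *: glact i j x.
  have := glmod_bracket V_mod k k i j x; rewrite /epar addbb /= expr0.
  move/eqP; rewrite subr_eq => /eqP ->.
  rewrite scale1r mul1r addrC scalerBl; congr (_ + (_ - _)).
    by case: eqP => [->|//]; rewrite ?scale0r.
  by case: eqP => [->|//]; rewrite ?scale0r.
rewrite /height act_sum.
under eq_bigr => k _ do rewrite commE scalerDr -glactZ scalerA.
rewrite big_split -scaler_suml; congr (_ + _ *: _).
under eq_bigr => k _ do rewrite mulrBr.
rewrite sumrB; congr (_ - _).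
  rewrite (bigD1 i) //= eqxx mulr1 big1 ?addr0 // => k /negPf ->.
  by rewrite mulr0.
rewrite (bigD1 j) //= eqxx mulr1 big1 ?addr0 // => k /negPf ->.
by rewrite mulr0.
Qed.

End Basics.

(** * The cyclic module of a highest weight vector *)

Section HighestWeight.

Variables (K : numFieldType) (p q : nat) (V : glrep K p q).
Hypothesis V_mod : is_glmod V.
Variables (lam : 'I_(p + q) -> K) (b : bool) (v : V).
Hypothesis v_hw : is_hwv lam v.
Hypothesis v_hom : glhom b v.

Let h0 : K := \sum_(i < p + q) i%:R * lam i.

Lemma height_hwv : height v = h0 *: v.
Proof.
rewrite /height scaler_suml; apply: eq_bigr => i _.
by case: v_hw => _ _ ->; rewrite scalerA.
Qed.

(** The polynomial in [height] with roots [h0 + d] for [d] in [s], applied to [x]. *)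
Fixpoint kill (s : seq nat) (x : V) : V :=
  if s is d :: s' then
    height (kill s' x) - (h0 + d%:R) *: kill s' x
  else x.

Lemma killP s c x y : kill s (c *: x + y) = c *: kill s x + kill s y.
Proof.
elim: s => //= d s ->; rewrite heightP //.
lmod_ring K V.
Qed.

Lemma kill0 s : kill s 0 = 0.
Proof.
by have := killP s (-1) 0 0; rewrite scaleN1r oppr0 addr0 scaleN1r addNr.
Qed.

Lemma kill_cat s t x : kill (s ++ t) x = kill s (kill t x).
Proof. by elim: s => //= d s ->. Qed.

Lemma kill_height s x : kill s (height x) = height (kill s x).
Proof.
elim: s => //= d s ->; rewrite [in RHS]addrC -[in RHS]scaleNr heightP //.
lmod_ring K V.
Qed.

Lemma killC s t x : kill s (kill t x) = kill t (kill s x).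
Proof.
elim: s => //= d s ->; rewrite [in RHS]addrC -[in RHS]scaleNr killP.
rewrite kill_height; lmod_ring K V.
Qed.

(** A lowering operator moves every eigenvalue of [height] up by [i - j], so the roots move with
    it. *)
Lemma kill_act (i j : 'I_(p + q)) s x : (j < i)%N ->
  kill [seq (i - j + d)%N | d <- s] (glact i j x) = glact i j (kill s x).
Proof.
move=> ji; elim: s => //= d s ->.
rewrite height_act // natrD natrB ?(ltnW ji) //.
have -> : height (kill s x) - (h0 + d%:R) *: kill s x
  = (- (h0 + d%:R)) *: kill s x + height (kill s x) by lmod_ring K V.
rewrite glactP //.
lmod_ring K V.
Qed.

Lemma kill_hw s x : height x = h0 *: x ->
  kill s x = (\prod_(d <- s) (- d%:R)) *: x.
Proof.
move=> hx; elim: s => [|d s IH] /=; first by rewrite big_nil scale1r.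
rewrite IH big_cons.
have := heightP V_mod (\prod_(d <- s) (- d%:R)) x 0.
have h00 : height (0 : V) = 0.
  by have := heightP V_mod (-1) (0 : V) 0;
     rewrite scaleN1r oppr0 addr0 scaleN1r addNr.
rewrite h00 !addr0 hx => ->.
lmod_ring K V.
Qed.

(** Such an [x] lies in a sum of generalised eigenspaces of [height] for eigenvalues [h0 + d] with
    [d >= 1], that is, strictly below [v] in the weight order. *)
Definition below (x : V) : Prop :=
  exists2 s : seq nat, all (leq 1) s & kill s x = 0.

Lemma below0 : below 0.
Proof. by exists [::]. Qed.

Lemma belowP c x y : below x -> below y -> below (c *: x + y).
Proof.
(* The factors commute, so the product of the two polynomials annihilates both vectors. *)
case=> s s1 sx [t t1 ty]; exists (s ++ t); first by rewrite all_cat s1.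
by rewrite killP kill_cat killC sx !kill0 scaler0 kill_cat ty kill0 addr0.
Qed.

Lemma below_act (i j : 'I_(p + q)) x :
  (j < i)%N -> below x -> below (glact i j x).
Proof.
move=> ji [s s1 sx]; exists [seq (i - j + d)%N | d <- s].
  by rewrite all_map; apply/allP => d ds /=; rewrite addn_gt0 subn_gt0 ji.
by rewrite kill_act // sx glact0.
Qed.

Lemma below_act_hwv (i j : 'I_(p + q)) : (j < i)%N -> below (glact i j v).
Proof.
move=> ji; exists [:: (i - j)%N]; first by rewrite /= subn_gt0 ji.
rewrite /= height_act // height_hwv glactZ // natrB ?(ltnW ji) //.
lmod_ring K V.
Qed.

(** On the [h0]-eigenspace each factor of the polynomial is [-d], nonzero for [d >= 1]. *)
Lemma below_height_eq0 x : height x = h0 *: x -> below x -> x = 0.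
Proof.
move=> hx [s s1]; rewrite kill_hw // => /eqP.
rewrite scaler_eq0 => /orP[|/eqP//].
elim: s s1 => [_|d s IH /= /andP[d1 s1]]; first by rewrite big_nil oner_eq0.
by rewrite big_cons mulf_eq0 oppr_eq0 pnatr_eq0 -leqn0 leqNgt d1; exact: IH.
Qed.

(** The filtration of [U(n^-) v] by the length of the lowering words. *)
Inductive lowspan : nat -> V -> Prop :=
| lowspan_hwv k : lowspan k v
| lowspanP k c x y : lowspan k x -> lowspan k y -> lowspan k (c *: x + y)
| lowspan_act k (i j : 'I_(p + q)) x :
    (j < i)%N -> lowspan k x -> lowspan k.+1 (glact i j x).

Lemma lowspan0 k : lowspan k 0.
Proof.
by rewrite -(addNr v) -scaleN1r; apply: lowspanP; apply: lowspan_hwv.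
Qed.

Lemma lowspanZ k c x : lowspan k x -> lowspan k (c *: x).
Proof. by move=> xl; rewrite -[_ *: _]addr0; apply/lowspanP/lowspan0. Qed.

Lemma lowspanD k x y : lowspan k x -> lowspan k y -> lowspan k (x + y).
Proof. by move=> xl yl; rewrite -[x]scale1r; apply: lowspanP. Qed.

Lemma lowspan_leq k k' x : (k <= k')%N -> lowspan k x -> lowspan k' x.
Proof.
move=> kk' xl; elim: xl k' kk' => {k x} [k|k c x y _ IHx _ IHy|k i j x ji _ IH].
- by move=> k' _; apply: lowspan_hwv.
- by move=> k' kk'; apply: lowspanP; [apply: IHx|apply: IHy].
- by case=> // k' kk'; apply: lowspan_act => //; apply: IH.
Qed.

(** The operator is commuted past the leftmost lowering operator; the bracket terms act on the
    shorter word, where any [e_ij] is either one more lowering operator or covered by the induction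
    hypothesis. *)
Lemma lowspan_raise k x (i j : 'I_(p + q)) :
  (i <= j)%N -> lowspan k x -> lowspan k (glact i j x).
Proof.
move=> ij xl.
elim: xl i j ij => {k x} [k|k c x y _ IHx _ IHy|k k1 k2 x k21 xl IH] i j ij.
- case: v_hw => _ raise wt; move: ij.
  rewrite leq_eqVlt => /orP[/eqP/val_inj->|ij].
    by rewrite wt; apply/lowspanZ/lowspan_hwv.
  by rewrite raise //; apply: lowspan0.
- by rewrite glactP //; apply: lowspanP; [apply: IHx|apply: IHy].
- have step k3 k4 : lowspan k.+1 (glact k3 k4 x).
    have [k34|k43] := leqP k3 k4; last exact: lowspan_act.
    exact: lowspan_leq (leqnSn k) (IH _ _ k34).
  have := glmod_bracket V_mod i j k1 k2 x; cbv zeta.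
  move/eqP; rewrite subr_eq => /eqP ->.
  rewrite -scaleNr; apply: lowspanD; last first.
    by apply/lowspanZ/lowspan_act/IH.
  by apply: lowspanD; apply/lowspanZ/step.
Qed.

(** Holds because [v] and all the operators are homogeneous; it makes the span a graded subspace. *)
Lemma lowspan_hom k x : lowspan k x ->
  exists x0 x1, [/\ glhom false x0, glhom true x1, lowspan k x0, lowspan k x1
    & x = x0 + x1].
Proof.
elim=> {k x} [k|k c x y _ [x0 [x1 [x0h x1h x0l x1l ->]]]
    _ [y0 [y1 [y0h y1h y0l y1l ->]]]
  |k i j x ji _ [x0 [x1 [x0h x1h x0l x1l ->]]]].
- case: b v_hom => vh.
    exists 0, v; rewrite add0r; split=> //; first exact: glmod_hom0.
      exact: lowspan0.
    exact: lowspan_hwv.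
  exists v, 0; rewrite addr0; split=> //; first exact: glmod_hom0.
    exact: lowspan_hwv.
  exact: lowspan0.
- exists (c *: x0 + y0), (c *: x1 + y1); split; try exact: glmod_homP.
  + exact: lowspanP.
  + exact: lowspanP.
  + by rewrite scalerDr addrACA.
- have hom0 := glmod_act_hom V_mod i j x0h.
  have hom1 := glmod_act_hom V_mod i j x1h.
  rewrite glactD //; case: (epar i j) hom0 hom1 => /= hom0 hom1.
    by exists (glact i j x1), (glact i j x0); split=> //;
      [apply: lowspan_act|apply: lowspan_act|rewrite addrC].
  by exists (glact i j x0), (glact i j x1); split=> //; apply: lowspan_act.
Qed.

Lemma lowspan_below k x : lowspan k x -> exists c y, x = c *: v + y /\ below y.
Proof.
elim=> {k x} [k|k c x y _ [c1 [x1 [-> x1b]]] _ [c2 [x2 [-> x2b]]]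
    |k i j x ji _ [c [y [-> yb]]]].
- by exists 1, 0; rewrite scale1r addr0; split=> //; exact: below0.
- exists (c * c1 + c2), (c *: x1 + x2); split; last exact: belowP.
  by rewrite scalerDr addrACA scalerA scalerDl.
- exists 0, (glact i j (c *: v + y)); rewrite scale0r add0r; split=> //.
  by rewrite glactP //; apply: belowP; [apply: below_act_hwv|apply: below_act].
Qed.

(** Built from lowering operators only, yet stable under all of them, hence the submodule generated
    by [v]. *)
Definition cyclic (x : V) : Prop := exists k, lowspan k x.

Lemma cyclic_hwv : cyclic v.
Proof. by exists 0%N; apply: lowspan_hwv. Qed.

Lemma cyclic_submod : is_submod cyclic.
Proof.
split.
- by exists 0%N; apply: lowspan0.
- move=> c x y [k xk] [l yl]; exists (maxn k l).
  apply: lowspanP; first exact: lowspan_leq (leq_maxl _ _) xk.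
  exact: lowspan_leq (leq_maxr _ _) yl.
- move=> x0 x1 x0h x1h [k] /lowspan_hom [y0 [y1 [y0h y1h y0l y1l E]]].
  by have [-> ->] := glhom_unique V_mod x0h x1h y0h y1h E; split; exists k.
- move=> i j x [k xk]; have [ij|ji] := leqP i j.
    by exists k; apply: lowspan_raise.
  by exists k.+1; apply: lowspan_act.
Qed.

(** Subtracting the multiple of [v] leaves a vector that is both in [below] and an [h0]-eigenvector,
    hence zero. *)
Lemma cyclic_height x : cyclic x -> height x = h0 *: x -> exists c, x = c *: v.
Proof.
case=> k /lowspan_below [c [y [xE yb]]] hx; exists c.
suff y0 : y = 0 by rewrite xE y0 addr0.
apply: below_height_eq0 yb.
have -> : y = (- c) *: v + x by rewrite xE scaleNr addKr.
rewrite heightP // hx height_hwv; lmod_ring K V.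
Qed.

End HighestWeight.

(** * Direct sums of graded modules *)

Section DirectSum.

Variables (K : numFieldType) (p q : nat) (V W : glrep K p q).
Hypotheses (V_mod : is_glmod V) (W_mod : is_glmod W).

Definition glsum : glrep K p q := @GLRep K p q (V * W)%type
  (fun b x => glhom b x.1 /\ glhom b x.2)
  (fun i j x => (glact i j x.1, glact i j x.2)).

Lemma glsum_mod : is_glmod glsum.
Proof.
split=> /=.
- by move=> i j c [x1 x2] [y1 y2] /=; rewrite !glactP.
- by move=> b; split; apply: glmod_hom0.
- by move=> b c [x1 x2] [y1 y2] [??] [??]; split; apply: glmod_homP.
- move=> [x y]; have [x0 [x1 [x0h x1h ->]]] := glmod_homD V_mod x.
  have [y0 [y1 [y0h y1h ->]]] := glmod_homD W_mod y.
  by exists (x0, y0), (x1, y1).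
- move=> [x y] /= [x0 y0] [x1 y1]; congr (_, _).
    exact: (glmod_homI V_mod).
  exact: (glmod_homI W_mod).
- by move=> i j b [x y] [xh yh]; split; apply: glmod_act_hom.
- move=> i j k l [x y]; congr (_, _).
    exact: (glmod_bracket V_mod).
  exact: (glmod_bracket W_mod).
Qed.

Lemma glsum_height (x : glsum) : height x = (height x.1, height x.2).
Proof.
rewrite /height [LHS]surjective_pairing.
by rewrite (raddf_sum fst) (raddf_sum snd).
Qed.

End DirectSum.

(** * The graph of an isomorphism inside a direct sum *)

Section SimpleIso.

Variables (K : numFieldType) (p q : nat) (V W : glrep K p q).
Hypotheses (V_mod : is_glmod V) (W_mod : is_glmod W).
Hypotheses (V_simple : is_simple V) (W_simple : is_simple W).
Variables (lam : 'I_(p + q) -> K) (b : bool) (v : V) (w : W).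
Hypotheses (v_hw : is_hwv lam v) (w_hw : is_hwv lam w).
Hypotheses (v_hom : glhom b v) (w_hom : glhom b w).

Let P := glsum V W.
Let vw : P := (v, w).
Let P_mod : is_glmod P := glsum_mod V_mod W_mod.

Lemma glsum_hwv : is_hwv (V := P) lam vw.
Proof.
case: v_hw w_hw => v0 v_up v_wt [w0 w_up w_wt]; split.
- by case.
- by move=> i j ij; congr (_, _); [apply: v_up|apply: w_up].
- by move=> i; congr (_, _); [apply: v_wt|apply: w_wt].
Qed.

Let vw_hom : glhom b vw. Proof. by []. Qed.

Let M : P -> Prop := cyclic vw.

Let M_sub : is_submod M := cyclic_submod P_mod glsum_hwv vw_hom.

(** The slice of [M] over [0] is a submodule of [W]. Were it all of [W], then [(0, w)] would lie on
    the eigenline of [(v, w)], forcing [w = 0]. *)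
Lemma simple_graph_inj y : M (0, y) -> y = 0.
Proof.
case: (M_sub) => M0 MP Mhom Mact.
have N_sub : is_submod (fun y : W => M (0, y)).
  split=> //.
  - move=> c x1 x2 Mx1 Mx2; have := MP c _ _ Mx1 Mx2.
    suff -> : c *: ((0, x1) : P) + (0, x2) = (0, c *: x1 + x2) by [].
    by congr (_, _); rewrite /= ?scaler0 ?addr0.
  - move=> x0 x1 x0h x1h Mx.
    apply: (Mhom (0, x0) (0, x1)).
    + by split=> //; apply: glmod_hom0.
    + by split=> //; apply: glmod_hom0.
    + suff -> : ((0, x0) : P) + (0, x1) = (0, x0 + x1) by [].
      by congr (_, _); rewrite /= addr0.
  - move=> i j x Mx; have := Mact i j _ Mx.
    by rewrite /= glact0.
have [N0|NT] := proj2 W_simple _ N_sub; first exact: N0.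
have [|c] := cyclic_height P_mod glsum_hwv (NT w).
  rewrite glsum_height /=; congr (_, _); last exact: height_hwv w_hw.
  have := heightP V_mod (-1) (0 : V) 0.
  by rewrite scaleN1r oppr0 addr0 scaleN1r addNr scaler0.
case=> /esym/eqP; case: v_hw => /eqP/negPf v0 _ _.
rewrite scaler_eq0 v0 orbF => /eqP -> ; rewrite scale0r => w0.
by case: w_hw.
Qed.

(** The projection of [M] to [V] is a submodule containing [v], hence everything. *)
Lemma simple_graph_dom x : exists y, M (x, y).
Proof.
case: (M_sub) => M0 MP Mhom Mact.
have N_sub : is_submod (fun x : V => exists y, M (x, y)).
  split.
  - by exists 0.
  - move=> c x1 x2 [y1 Mx1] [y2 Mx2]; exists (c *: y1 + y2).
    exact: MP c _ _ Mx1 Mx2.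
  - move=> x0 x1 x0h x1h [y Mx].
    have [y0 [y1 [y0h y1h yE]]] := glmod_homD W_mod y.
    have [] := Mhom (x0, y0) (x1, y1) (conj x0h y0h) (conj x1h y1h).
      by move: Mx; rewrite yE.
    by split; [exists y0|exists y1].
  - by move=> i j x1 [y1 Mx]; exists (glact i j y1); apply: Mact Mx.
have [N0|NT] := proj2 V_simple _ N_sub; last exact: NT.
have := N0 v; case: v_hw => v0 _ _ vE; case: v0; apply: vE.
by exists w; apply: cyclic_hwv.
Qed.

End SimpleIso.

(** Lets the two facts about the graph be reused with [V] and [W] exchanged, which gives the inverse
    map. *)
Lemma cyclic_swap (K : numFieldType) (p q : nat) (V W : glrep K p q)
    (v : V) (w : W) x :
  cyclic (V := glsum V W) (v, w) x -> cyclic (V := glsum W V) (w, v) (x.2, x.1).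
Proof.
case=> k xk; exists k.
elim: xk => {k x} [k|k c x y _ IHx _ IHy|k i j x ji _ IH].
- exact: lowspan_hwv.
- exact: lowspanP IHx IHy.
- exact: lowspan_act ji IH.
Qed.

Lemma simple_hw_iso (K : numFieldType) (p q : nat) (V W : glrep K p q)
    (lam : 'I_(p + q) -> K) (b : bool) (v : V) (w : W) :
  is_L lam b v -> is_L lam b w -> gl_iso V W.
Proof.
move=> [Vm Vs vhw vh] [Wm Ws whw wh].
pose M := cyclic (V := glsum V W) (v, w).
have Pm := glsum_mod Vm Wm.
have [M0 MP Mhom Mact] : is_submod M.
  exact: (cyclic_submod Pm (glsum_hwv vhw whw) (conj vh wh)).
have MB x y : M x -> M y -> M (x - y).
  by move=> Mx My; rewrite addrC -scaleN1r; apply: MP.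
have inj1 x y1 y2 : M (x, y1) -> M (x, y2) -> y1 = y2.
  move=> M1 M2; apply/eqP; rewrite -subr_eq0; apply/eqP.
  apply: (simple_graph_inj Vm Wm Ws vhw whw vh wh).
  by have := MB _ _ M1 M2; congr M; congr (_, _); rewrite /= subrr.
have inj2 x1 x2 y : M (x1, y) -> M (x2, y) -> x1 = x2.
  move=> M1 M2; apply/eqP; rewrite -subr_eq0; apply/eqP.
  apply: (simple_graph_inj Wm Vm Vs whw vhw wh vh).
  apply: (@cyclic_swap _ _ _ V W _ _ (_, 0)).
  by have := MB _ _ M1 M2; congr M; congr (_, _); rewrite /= subrr.
have dom1 := simple_graph_dom Vm Wm Vs vhw whw vh wh.
have dom2 y : exists x, M (x, y).
  have [x /cyclic_swap Mx] := simple_graph_dom Wm Vm Ws whw vhw wh vh y.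
  by exists x.
have [f fM] := choice dom1; have [g gM] := choice dom2.
have f_lin : linear f.
  move=> c x y; apply: inj1 (fM _) _.
  exact: MP c _ _ (fM x) (fM y).
pose fL := GRing.isLinear.Build _ _ _ _ f f_lin.
pose F : {linear V -> W} := HB.pack f fL.
exists F; split=> /=.
- exists g => x /=; first exact: inj2 (gM _) (fM _).
  exact: inj1 (fM _) (gM _).
- move=> c x xh.
  have [y0 [y1 [y0h y1h yE]]] := glmod_homD Wm (f x).
  have Mx := fM x; rewrite yE in Mx.
  (* [M] is graded, so the component of [f x] of the wrong parity is paired with [0] and splits off;
     the rest is again an image of [x]. *)
  case: c xh => xh.
    have [|||_ Mx1] := Mhom (0, y0) (x, y1).
    + by split=> //; apply: glmod_hom0.
    + by [].
    + by move: Mx; congr M; congr (_, _); rewrite /= add0r.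
    by rewrite (inj1 _ _ _ (fM x) Mx1).
  have [|||Mx1 _] := Mhom (x, y0) (0, y1).
  + by [].
  + by split=> //; apply: glmod_hom0.
  + by move: Mx; congr M; congr (_, _); rewrite /= addr0.
  by rewrite (inj1 _ _ _ (fM x) Mx1).
- move=> i j x; apply: inj1 (fM _) _.
  exact: Mact i j _ (fM x).
Qed.

(** * Operators on F_a (x) L *)

Section Exponents.

Variables (K : numFieldType) (m n : nat).

Local Notation I := 'I_(m + n).
Local Notation expt := {ffun 'I_(m + n) -> nat}.

(** Exponents are handled as arbitrary functions, so that these shifts are total; exponents that are
    not legal, such as that of [t_i^2] for odd [t_i], give the zero vector through [tmon]. *)
Definition addx (k : expt) (i : I) : expt := [ffun j => (k j + (j == i))%N].
Definition subx (k : expt) (i : I) : expt := [ffun j => (k j - (j == i))%N].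

Definition ksign (i : I) (k : expt) : K :=
  (-1) ^+ (ipar i * \sum_(j | ipar j && (j < i)%N) k j).

(* For an odd variable [odd (k i)] is the exponent on the actual monomials, and
   vanishes on t_i^2, which makes [Dop_tmon] hold for all k. *)
Definition dcoef (i : I) (k : expt) : K :=
  if ipar i then (odd (k i))%:R else (k i)%:R.

Definition xpar (k : expt) : bool := odd (\sum_(j | ipar j) k j)%N.

Lemma expoP (k : expt) : is_expo k -> exists k' : expo m n, k = val k'.
Proof. by move=> kE; exists (exist _ k kE). Qed.

Lemma is_expo_addx (k : expt) i : is_expo (addx k i) -> is_expo k.
Proof.
move=> /forallP H; apply/forallP => j; apply/implyP => jb.
by have := implyP (H j) jb; rewrite ffunE; apply: leq_trans; rewrite leq_addr.
Qed.

Lemma subx_addx (k : expt) i : subx (addx k i) i = k.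
Proof. by apply/ffunP => j; rewrite !ffunE addnK. Qed.

Lemma addx_subx (k : expt) i : (0 < k i)%N -> addx (subx k i) i = k.
Proof.
move=> ki; apply/ffunP => j; rewrite !ffunE subnK //.
by case: eqP => [->|].
Qed.

Lemma addxC (k : expt) i j : addx (addx k i) j = addx (addx k j) i.
Proof. by apply/ffunP => l; rewrite !ffunE addnAC. Qed.

Lemma sum_addx (P : pred I) (k : expt) i :
  (\sum_(j | P j) addx k i j = \sum_(j | P j) k j + P i)%N.
Proof.
under eq_bigr do rewrite ffunE.
rewrite big_split /=; congr (_ + _)%N; case Pi: (P i).
  by rewrite (bigD1 i) //= eqxx big1 ?addn0 // => j /andP[_ /negPf ->].
by rewrite big1 // => j Pj; case: eqP => // ji; rewrite ji Pi in Pj.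
Qed.

Lemma ksign_addx i (k : expt) j :
  ksign i (addx k j) = (-1) ^+ (ipar i && ipar j && (j < i)%N) * ksign i k.
Proof.
rewrite /ksign sum_addx mulnDr exprD mulrC; congr (_ * _).
by case: (ipar i); case: (ipar j); case: (j < i)%N.
Qed.

Lemma ksign2 i (k : expt) : ksign i k * ksign i k = 1.
Proof. by rewrite /ksign -exprD addnn -mul2n exprM sqrrN expr1n expr1n. Qed.

Lemma xpar_addx (k : expt) i : xpar (addx k i) = ipar i (+) xpar k.
Proof. by rewrite /xpar sum_addx oddD addbC; case: (ipar i). Qed.

Lemma dcoef_addx_neq i j (k : expt) : i != j -> dcoef i (addx k j) = dcoef i k.
Proof. by move=> ij; rewrite /dcoef !ffunE (negPf ij) addn0. Qed.

(** The Leibniz rule for the derivative of [t_i] times a monomial, read on coefficients. *)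
Lemma dcoef_addx i (k : expt) :
  dcoef i (addx k i) = 1 + (-1) ^+ ipar i * dcoef i k.
Proof.
rewrite /dcoef !ffunE eqxx addn1; case: ipar => /=.
  by case: (odd (k i)) => /=; ring.
by rewrite -[in LHS]addn1 natrD; ring.
Qed.

Lemma dcoef_eq0 i (k : expt) : k i = 0%N -> dcoef i k = 0.
Proof. by rewrite /dcoef => ->; case: ipar. Qed.

Definition sg (i j : I) : K := (-1) ^+ (ipar i && ipar j).

End Exponents.

(* The operators are locked because comparing two distinct elements of FaL by
   conversion does not terminate in practice. *)
HB.lock Definition embed :=
  fun (K : numFieldType) (m n : nat) (L : glrep K m n)
      (k : expo m n) (u : L) =>
    << u *g k >> : FaL L.

HB.lock Definition fext :=
  fun (K : numFieldType) (m n : nat) (L : glrep K m n)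
      (g : expo m n -> L -> FaL L) (x : FaL L) =>
    \sum_(k <- msupp x) g k (mcoeff k x) : FaL L.

(* t^k (x) u, with value 0 when k is not an exponent *)
HB.lock Definition tmon :=
  fun (K : numFieldType) (m n : nat) (L : glrep K m n)
      (k : {ffun 'I_(m + n) -> nat}) (u : L) =>
    (if insub k is Some k' then embed (k' : expo m n) u else 0) : FaL L.

(* t_i / t_0 *)
HB.lock Definition Xop :=
  fun (K : numFieldType) (m n : nat) (L : glrep K m n) (i : 'I_(m + n)) =>
    fext (fun (k : expo m n) (u : L) =>
      ksign K i (val k) *: tmon (addx (val k) i) u).

(* t_0 d/dt_i *)
HB.lock Definition Dop :=
  fun (K : numFieldType) (m n : nat) (L : glrep K m n) (i : 'I_(m + n)) =>
    fext (fun (k : expo m n) (u : L) =>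
      (ksign K i (val k) * dcoef K i (val k)) *: tmon (subx (val k) i) u).

(* t_0 d/dt_0 *)
HB.lock Definition Eop :=
  fun (K : numFieldType) (m n : nat) (L : glrep K m n) (a : K) =>
    fext (fun (k : expo m n) (u : L) =>
      (a - (expo_sum k)%:R) *: embed k u).

(* 1 (x) e_st *)
HB.lock Definition eop :=
  fun (K : numFieldType) (m n : nat) (L : glrep K m n) (s t : 'I_(m + n)) =>
    fext (fun (k : expo m n) (u : L) =>
      (-1) ^+ (epar s t && xpar (val k)) *: embed k (glact s t u)).

(** The part of [e_s0] that involves [L], up to its overall sign. *)
HB.lock Definition Yop :=
  fun (K : numFieldType) (m n : nat) (L : glrep K m n) (s : 'I_(m + n))
      (x : FaL L) =>
    \sum_(l < m + n) sg K s l *: Xop l (eop s l x) : FaL L.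

(** * Commutation relations of the operators on [F_a (x) L] *)

Section TensorOperators.

Variables (K : numFieldType) (m n : nat) (L : glrep K m n).

Local Notation I := 'I_(m + n).
Local Notation F := (FaL L).
Local Notation Fa := (Fa K m n).
Local Notation expt := {ffun 'I_(m + n) -> nat}.

Local Notation embed := (@embed K m n L).
Local Notation fext := (@fext K m n L).
Local Notation tmon := (@tmon K m n L).
Local Notation Xop := (@Xop K m n L).
Local Notation Dop := (@Dop K m n L).
Local Notation Eop := (@Eop K m n L).
Local Notation eop := (@eop K m n L).
Local Notation Yop := (@Yop K m n L).
Local Notation ksign := (ksign K).
Local Notation dcoef := (dcoef K).
Local Notation sg := (sg K).

Definition coef (k : expo m n) (x : F) : L := mcoeff k x.

Lemma coef_is_linear k : linear (coef k).
Proof. by move=> c x y; rewrite /coef mcoeffD [X in X + _]FaL_scaleE. Qed.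

HB.instance Definition _ k :=
  GRing.isLinear.Build K F L _ (coef k) (coef_is_linear k).

Lemma FaL_eqP (x y : F) : (forall k, coef k x = coef k y) -> x = y.
Proof. by move=> H; apply/malgP. Qed.

Lemma coef_embed k k' u : coef k' (embed k u) = if k == k' then u else 0.
Proof.
by rewrite /coef embed.unlock mcoeffU; case: eqP; rewrite ?mulr1n ?mulr0n.
Qed.

Lemma coef_outdom k (x : F) : k \notin msupp x -> coef k x = 0.
Proof. exact: mcoeff_outdom. Qed.

Lemma embed_is_linear k : linear (embed k : L -> F).
Proof.
move=> c u w; apply: FaL_eqP => k'; rewrite linearP /= !coef_embed.
by case: eqP => _ //; rewrite scaler0 addr0.
Qed.

HB.instance Definition _ k :=
  GRing.isLinear.Build K L F _ (embed k) (embed_is_linear k).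

Lemma FaL_embedE (x : F) : x = \sum_(k <- msupp x) embed k (coef k x).
Proof.
by rewrite {1}[x]monalgE; apply: eq_bigr => k _; rewrite embed.unlock.
Qed.

Lemma FaL_ext (V : zmodType) (f g : F -> V) :
  (forall x y, f (x + y) = f x + f y) -> (forall x y, g (x + y) = g x + g y) ->
  (forall k u, f (embed k u) = g (embed k u)) -> f =1 g.
Proof.
move=> fD gD fg x.
have E0 (h : F -> V) : (forall x y, h (x + y) = h x + h y) -> h 0 = 0.
  by move=> hD; apply: (addrI (h 0)); rewrite -hD !addr0.
rewrite (FaL_embedE x).
elim: (enum_fset (msupp x)) => [|k s IH]; first by rewrite !big_nil !E0.
by rewrite !big_cons fD gD IH fg.
Qed.

Section Extension.

Variable g : expo m n -> L -> F.
Hypothesis g_linear : forall k, linear (g k).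

Let g0 k : g k 0 = 0.
Proof.
by have := g_linear k (-1) 0 0; rewrite scaleN1r oppr0 addr0 scaleN1r addNr.
Qed.

Lemma fextEw (d : {fset expo m n}) (x : F) :
  (msupp x `<=` d)%fset -> fext g x = \sum_(k <- d) g k (coef k x).
Proof.
move=> xd; rewrite fext.unlock (big_fset_incl _ xd) //= => k _ kx.
by rewrite [mcoeff _ _]coef_outdom ?g0.
Qed.

Lemma fext_is_linear : linear (fext g).
Proof.
(* One finite set containing all three supports, so that the sums compare termwise. *)
move=> c x y; pose d := (msupp x `|` msupp y `|` msupp (c *: x + y))%fset.
rewrite !(@fextEw d);
  try by rewrite /d; apply/fsubsetP => k; rewrite !inE => ->; rewrite ?orbT.
rewrite scaler_sumr -big_split; apply: eq_bigr => k _ /=.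
by rewrite linearP /= g_linear.
Qed.

Lemma fext_embed k u : fext g (embed k u) = g k u.
Proof.
rewrite (@fextEw [fset k]%fset) ?big_seq_fset1 ?coef_embed ?eqxx //.
by rewrite embed.unlock msuppU_le.
Qed.

End Extension.

Lemma tmon_is_linear k : linear (tmon k : L -> F).
Proof.
move=> c u w; rewrite !tmon.unlock; case: insub => [k'|]; first exact: linearP.
by rewrite scaler0 addr0.
Qed.

HB.instance Definition _ k :=
  GRing.isLinear.Build K L F _ (tmon k) (tmon_is_linear k).

Lemma tmon_val (k : expo m n) u : tmon (val k) u = embed k u.
Proof. by rewrite tmon.unlock valK. Qed.

Lemma tmon_not_expo (k : expt) u : ~~ is_expo k -> tmon k u = 0.
Proof. by move=> kN; rewrite tmon.unlock insubN. Qed.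

Let scale_linear (f : {linear L -> F}) c : linear (fun u => c *: f u).
Proof. by move=> c' u w; rewrite linearP; lmod_ring K (FaL L). Qed.

Lemma Xop_is_linear i : linear (Xop i : F -> F).
Proof.
by rewrite Xop.unlock; apply: fext_is_linear => k; apply: scale_linear.
Qed.

HB.instance Definition _ i :=
  GRing.isLinear.Build K F F _ (Xop i) (Xop_is_linear i).

Lemma Dop_is_linear i : linear (Dop i : F -> F).
Proof.
by rewrite Dop.unlock; apply: fext_is_linear => k; apply: scale_linear.
Qed.

HB.instance Definition _ i :=
  GRing.isLinear.Build K F F _ (Dop i) (Dop_is_linear i).

Lemma Eop_is_linear a : linear (Eop a : F -> F).
Proof.
by rewrite Eop.unlock; apply: fext_is_linear => k; apply: scale_linear.
Qed.

HB.instance Definition _ a :=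
  GRing.isLinear.Build K F F _ (Eop a) (Eop_is_linear a).

Lemma Xop_embed i k u :
  Xop i (embed k u) = ksign i (val k) *: tmon (addx (val k) i) u.
Proof. by rewrite Xop.unlock fext_embed // => k'; exact: scale_linear. Qed.

Lemma Dop_embed i k u :
  Dop i (embed k u) =
  (ksign i (val k) * dcoef i (val k)) *: tmon (subx (val k) i) u.
Proof. by rewrite Dop.unlock fext_embed // => k'; exact: scale_linear. Qed.

Lemma Eop_embed a k u :
  Eop a (embed k u) = (a - (expo_sum k)%:R) *: embed k u.
Proof. by rewrite Eop.unlock fext_embed // => k'; exact: scale_linear. Qed.

(** Raising an exponent never makes an illegal one legal, so both sides vanish in that case. *)
Lemma Xop_tmon i k u : Xop i (tmon k u) = ksign i k *: tmon (addx k i) u.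
Proof.
have [/expoP[k' ->]|kN] := boolP (is_expo k).
  by rewrite tmon_val Xop_embed ?tmon_val.
rewrite !tmon_not_expo ?linear0 ?scaler0 //.
by apply: contra kN; exact: is_expo_addx.
Qed.

Lemma Dop_tmon i k u :
  Dop i (tmon k u) = (ksign i k * dcoef i k) *: tmon (subx k i) u.
Proof.
have [/expoP[k' ->]|kN] := boolP (is_expo k).
  by rewrite tmon_val Dop_embed ?tmon_val.
rewrite tmon_not_expo // linear0.
have [|k'E] := boolP (is_expo (subx k i)); last first.
  by rewrite tmon_not_expo ?scaler0.
(* If removing one [t_i] makes [k] legal, then [t_i] is odd and [k i = 2], where [dcoef]
   vanishes. *)
move=> /forallP kE; suff -> : dcoef i k = 0 by rewrite mulr0 scale0r.
have /forallPn [j] := kN; rewrite negb_imply -ltnNge => /andP[jb kj].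
have := implyP (kE j) jb; rewrite ffunE.
case: eqP kj jb => [->|_] kj jb; last lia.
by rewrite /dcoef jb => k2; have -> : k i = 2%N by lia.
Qed.

Lemma Eop_tmon a k u : Eop a (tmon k u) = (a - (\sum_i k i)%:R) *: tmon k u.
Proof.
have [/expoP[k' ->]|kN] := boolP (is_expo k).
  by rewrite tmon_val Eop_embed ?tmon_val.
by rewrite !tmon_not_expo // linear0 scaler0.
Qed.

Let F_ext (f g : F -> F) :
  (forall x y, f (x + y) = f x + f y) -> (forall x y, g (x + y) = g x + g y) ->
  (forall k u, f (tmon k u) = g (tmon k u)) -> f =1 g.
Proof. by move=> fD gD H; apply: FaL_ext => // k u; rewrite -tmon_val. Qed.

Lemma XopC i j x : Xop i (Xop j x) = sg i j *: Xop j (Xop i x).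
Proof.
move: x; apply: F_ext => [x y|x y|k u].
- by rewrite !linearD.
- by rewrite !linearD.
rewrite !(Xop_tmon, linearZ) /= !Xop_tmon !scalerA.
have [<-|ij] := eqVneq i j.
  rewrite !ksign_addx ltnn andbF /sg andbb; case ib: (ipar i).
    (* Both sides contain the square of the odd variable [t_i]. *)
    rewrite tmon_not_expo ?scaler0 //; apply/forallPn; exists i.
    by rewrite ib !ffunE eqxx; lia.
  by rewrite /= !(expr0, mul1r, mulr1).
rewrite addxC; congr (_ *: _); rewrite !ksign_addx /sg.
case: (ipar i); case: (ipar j) => /=; rewrite ?expr0; try ring.
by have := ij; rewrite -val_eqE /=; case: ltngtP => //= _ _; ring.
Qed.

Lemma DXop i j x :
  Dop i (Xop j x) = (i == j)%:R *: x + sg i j *: Xop j (Dop i x).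
Proof.
move: x; apply: F_ext => [x y|x y|k u].
- by rewrite !linearD.
- by rewrite !linearD /=; lmod_ring K (FaL L).
rewrite !(Xop_tmon, Dop_tmon, linearZ) /= Xop_tmon Dop_tmon !scalerA.
have [<-|ij] := eqVneq i j.
  rewrite subx_addx dcoef_addx ksign_addx ltnn andbF mul1r /sg andbb /=.
  (* [subx] truncates at [0], so [addx_subx] needs [0 < k i]; when [k i = 0] the coefficient [dcoef]
     is zero instead. *)
  have [k0|k0] := posnP (k i).
    rewrite dcoef_eq0 // !(mulr0, mul0r, scale0r, addr0, mulr1).
    by rewrite ksign2.
  have <- : ksign i k = ksign i (subx k i).
    by rewrite -{1}(addx_subx k0) ksign_addx ltnn andbF mul1r.
  rewrite addx_subx // -scalerDl; congr (_ *: _).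
  have := ksign2 K i k; set s := ksign i k => s2.
  by rewrite mulrA s2 mul1r -[in LHS](mul1r (_ * dcoef _ _)) -s2; ring.
rewrite scale0r add0r dcoef_addx_neq //.
have [k0|k0] := posnP (k i).
  by rewrite dcoef_eq0 // !(mulr0, mul0r, scale0r).
have -> : subx (addx k j) i = addx (subx k i) j.
  by rewrite -{1}(addx_subx k0) addxC subx_addx.
congr (_ *: _); rewrite ksign_addx -[in ksign j k](addx_subx k0) ksign_addx /sg.
case: (ipar i); case: (ipar j) => /=; rewrite ?expr0; try ring.
by have := ij; rewrite -val_eqE /=; case: ltngtP => //= _ _; ring.
Qed.

Lemma DopC i j x : Dop i (Dop j x) = sg i j *: Dop j (Dop i x).
Proof.
move: x; apply: F_ext => [x y|x y|k u].
- by rewrite !linearD.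
- by rewrite !linearD.
rewrite !(Dop_tmon, linearZ) /= !Dop_tmon !scalerA.
have [<-|ij] := eqVneq i j.
  rewrite /sg andbb; case ib: (ipar i); last by rewrite mulr1 ?mul1r.
  (* [k i] and its predecessor are not both odd: the square of an odd derivation is zero. *)
  have d0 : dcoef i k * dcoef i (subx k i) = 0.
    rewrite /dcoef ib ffunE eqxx; case: (k i) => [|l]; first by rewrite mul0r.
    by rewrite subn1 /=; case: (odd l); rewrite /= ?mulr0 ?mul0r.
  rewrite mulrACA d0 [in RHS]mulrAC [in RHS]mulrACA d0.
  by rewrite !(mulr0, mul0r, scale0r).
have [ki|ki] := posnP (k i).
  have -> : dcoef i (subx k j) = 0 by rewrite dcoef_eq0 // ffunE ki.
  by rewrite (dcoef_eq0 K ki) !(mulr0, mul0r, scale0r).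
have [kj|kj] := posnP (k j).
  have -> : dcoef j (subx k i) = 0 by rewrite dcoef_eq0 // ffunE kj.
  by rewrite (dcoef_eq0 K kj) !(mulr0, mul0r, scale0r).
(* Both exponents are positive from here on; this form of [k] removes every truncated
   subtraction. *)
have [l ->] : exists l, k = addx (addx l i) j.
  exists (subx (subx k i) j); rewrite addxC addx_subx ?addx_subx //.
  by rewrite ffunE eq_sym (negPf ij) subn0.
have E : subx (addx (addx l i) j) i = addx l j by rewrite addxC subx_addx.
have ji : j != i by rewrite eq_sym.
have Ej : dcoef j (addx (addx l i) j) = dcoef j (addx l j).
  by rewrite addxC dcoef_addx_neq.
rewrite E !subx_addx !(dcoef_addx_neq K _ ij) Ej.
congr (_ *: _); rewrite !ksign_addx !ltnn !andbF /sg.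
case: (ipar i); case: (ipar j) => /=; rewrite ?expr0; try ring.
by have := ij; rewrite -val_eqE /=; case: ltngtP => //= _ _; ring.
Qed.

(** Multiplication by [t_i / t_0] costs one power of [t_0]. *)
Lemma EXop a i x : Eop a (Xop i x) = Xop i (Eop a x) - Xop i x.
Proof.
move: x; apply: F_ext => [x y|x y|k u].
- by rewrite !linearD.
- by rewrite !linearD /=; lmod_ring K (FaL L).
rewrite !(Xop_tmon, Eop_tmon, linearZ) /= Xop_tmon Eop_tmon sum_addx addn1.
rewrite -natr1; lmod_ring K (FaL L).
Qed.

Lemma EDop a i x : Eop a (Dop i x) = Dop i (Eop a x) + Dop i x.
Proof.
move: x; apply: F_ext => [x y|x y|k u].
- by rewrite !linearD.
- by rewrite !linearD /=; lmod_ring K (FaL L).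
rewrite !(Dop_tmon, Eop_tmon, linearZ) /= Dop_tmon Eop_tmon.
have [ki|ki] := posnP (k i).
  by rewrite dcoef_eq0 // !(mulr0, mul0r, scale0r, scaler0) addr0.
rewrite -[in X in _ = X *: _ + _](addx_subx ki) sum_addx addn1 -natr1.
lmod_ring K (FaL L).
Qed.

Hypothesis L_mod : is_glmod L.

Let eop_summand_linear s t (k : expo m n) : linear (fun u =>
  (-1) ^+ (epar s t && xpar (val k)) *: embed k (glact s t u)).
Proof. by move=> c u w; rewrite glactP // linearP /=; lmod_ring K (FaL L). Qed.

Lemma eop_is_linear s t : linear (eop s t : F -> F).
Proof.
by rewrite eop.unlock; apply: fext_is_linear => k; apply: eop_summand_linear.
Qed.

HB.instance Definition _ s t :=
  GRing.isLinear.Build K F F _ (eop s t) (eop_is_linear s t).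

Lemma eop_embed s t k u : eop s t (embed k u) =
  (-1) ^+ (epar s t && xpar (val k)) *: embed k (glact s t u).
Proof.
by rewrite eop.unlock fext_embed // => k'; exact: eop_summand_linear.
Qed.

Lemma eop_tmon s t k u : eop s t (tmon k u) =
  (-1) ^+ (epar s t && xpar k) *: tmon k (glact s t u).
Proof.
have [/expoP[k' ->]|kN] := boolP (is_expo k).
  by rewrite tmon_val eop_embed ?tmon_val.
by rewrite !tmon_not_expo // linear0 scaler0.
Qed.

Lemma eXop s t i x :
  eop s t (Xop i x) = (-1) ^+ (epar s t && ipar i) *: Xop i (eop s t x).
Proof.
move: x; apply: F_ext => [x y|x y|k u].
- by rewrite !linearD.
- by rewrite !linearD.
rewrite !(Xop_tmon, eop_tmon, linearZ) /= !(Xop_tmon, eop_tmon) xpar_addx.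
rewrite !scalerA; congr (_ *: _).
by case: (epar s t); case: (ipar i); case: (xpar k); rewrite /=; ring.
Qed.

Lemma eDop s t i x :
  eop s t (Dop i x) = (-1) ^+ (epar s t && ipar i) *: Dop i (eop s t x).
Proof.
move: x; apply: F_ext => [x y|x y|k u].
- by rewrite !linearD.
- by rewrite !linearD.
rewrite !(Dop_tmon, eop_tmon, linearZ) /= !(Dop_tmon, eop_tmon).
have [ki|ki] := posnP (k i).
  by rewrite dcoef_eq0 // !(mulr0, mul0r, scale0r, scaler0).
rewrite -[in xpar k](addx_subx ki) xpar_addx.
rewrite !scalerA; congr (_ *: _).
by case: (epar s t); case: (ipar i); case: (xpar _); rewrite /=; ring.
Qed.

Lemma eEop a s t x : eop s t (Eop a x) = Eop a (eop s t x).
Proof.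
move: x; apply: F_ext => [x y|x y|k u].
- by rewrite !linearD.
- by rewrite !linearD.
rewrite !(Eop_tmon, eop_tmon, linearZ) /= !(Eop_tmon, eop_tmon).
lmod_ring K (FaL L).
Qed.

Lemma eopC i j k l x : eop i j (eop k l x) =
  (-1) ^+ (epar i j && epar k l) *: eop k l (eop i j x)
  + (j == k)%:R *: eop i l x
  - ((-1) ^+ (epar i j && epar k l) * (i == l)%:R) *: eop k j x.
Proof.
move: x; apply: F_ext => [x y|x y|e u].
- by rewrite !linearD.
- by rewrite !linearD /=; lmod_ring K (FaL L).
rewrite !(eop_tmon, linearZ) /= !eop_tmon.
have := glmod_bracket L_mod i j k l u; cbv zeta => /eqP.
rewrite subr_eq => /eqP ->; rewrite !linearD !linearN !linearZ /=.
(* Equal indices share their parity; the rest is a finite check over parities. *)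
have [<-{k}|_] := eqVneq j k; have [<-{l}|_] := eqVneq i l;
  rewrite /epar; move: (ipar i) (ipar j) (xpar e).
- by do 3!case; rewrite /=; lmod_ring K (FaL L).
- by move: (ipar l); do 4!case; rewrite /=; lmod_ring K (FaL L).
- by move: (ipar k); do 4!case; rewrite /=; lmod_ring K (FaL L).
- by move: (ipar k) (ipar l); do 5!case; rewrite /=; lmod_ring K (FaL L).
Qed.

Lemma Yop_is_linear s : linear (Yop s : F -> F).
Proof.
move=> c x y; rewrite !Yop.unlock scaler_sumr -big_split.
apply: eq_bigr => l _ /=.
by rewrite !linearP /=; lmod_ring K (FaL L).
Qed.

HB.instance Definition _ s :=
  GRing.isLinear.Build K F F _ (Yop s) (Yop_is_linear s).

Lemma YXop s t x : Yop s (Xop t x) = sg s t *: Xop t (Yop s x).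
Proof.
rewrite !Yop.unlock linear_sum scaler_sumr; apply: eq_bigr => l _.
rewrite eXop !linearZ /= XopC !scalerA; congr (_ *: _).
rewrite /sg /epar.
by case: (ipar s); case: (ipar t); case: (ipar l); rewrite /=; ring.
Qed.

(** The derivation hits only the factor [t_t / t_0] of the summand [l = t], which leaves [e_st]. *)
Lemma DYop t s x :
  Dop t (Yop s x) = sg s t *: Yop s (Dop t x) + sg s t *: eop s t x.
Proof.
rewrite !Yop.unlock linear_sum scaler_sumr /=.
under eq_bigr => l _ do rewrite linearZ /= DXop.
rewrite (bigD1 t) //= [in RHS](bigD1 t) //= eqxx.
set S1 := \sum_(i | _) _; set S2 := \sum_(i | _) _.
have -> : S1 = S2.
  apply: eq_bigr => l lt.
  rewrite eq_sym (negPf lt) eDop scale0r add0r !linearZ /=.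
  rewrite !scalerA; congr (_ *: _); rewrite /sg /epar.
  by case: (ipar s); case: (ipar t); case: (ipar l); rewrite /=; ring.
rewrite eDop !linearZ /= /sg /epar.
by case: (ipar s); case: (ipar t); rewrite /=; lmod_ring K (FaL L).
Qed.

Lemma EYop a s x : Eop a (Yop s x) = Yop s (Eop a x) - Yop s x.
Proof.
rewrite !Yop.unlock linear_sum -sumrB; apply: eq_bigr => l _.
by rewrite linearZ /= EXop eEop; lmod_ring K (FaL L).
Qed.

(** In the bracket of [e_st] with [e_s'l], the terms for [t = s'] add up to [Yop s], while the other
    term survives only for [l = s]. *)
Lemma eYop s t s' x : eop s t (Yop s' x) =
  (-1) ^+ (epar s t && ipar s') *: Yop s' (eop s t x)
  + (t == s')%:R *: Yop s x - sg t s' *: Xop s (eop s' t x).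
Proof.
rewrite !Yop.unlock linear_sum !scaler_sumr -big_split /=.
rewrite (bigD1 s) //= [X in _ = X - _](bigD1 s) //=.
set S1 := \sum_(i | _) _; set S2 := \sum_(i | _) _.
have -> : S1 = S2.
  apply: eq_bigr => l ls.
  rewrite linearZ /= eXop eopC [s == l]eq_sym (negPf ls).
  rewrite !(linearD, linearN, linearZ) /=.
  have [->|_] := eqVneq t s'; rewrite /sg /epar;
    move: (ipar s) (ipar s') (ipar l).
    by do 3!case; rewrite /=; lmod_ring K (FaL L).
  by move: (ipar t); do 4!case; rewrite /=; lmod_ring K (FaL L).
rewrite linearZ /= eXop eopC eqxx !(linearD, linearN, linearZ) /=.
have [->|_] := eqVneq t s'; rewrite /sg /epar; move: (ipar s) (ipar s').
  by do 2!case; rewrite /=; lmod_ring K (FaL L).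
by move: (ipar t); do 3!case; rewrite /=; lmod_ring K (FaL L).
Qed.

(** In the bracket of [e_s0] and [e_s'0] the two extra terms cancel those produced by moving [Eop]
    past [Yop]. *)
Lemma YopC s s' x : Yop s (Yop s' x) = sg s s' *: Yop s' (Yop s x)
  + sg s s' *: Xop s' (Yop s x) - Xop s (Yop s' x).
Proof.
have -> : Yop s' (Yop s x) =
    \sum_l (sg s l * sg s' l) *: Xop l (Yop s' (eop s l x)).
  rewrite {2}Yop.unlock linear_sum; apply: eq_bigr => l _.
  by rewrite linearZ /= YXop scalerA.
(* Written as a sum over [l] with a single nonzero term, to allow a termwise comparison. *)
have -> : sg s s' *: Xop s' (Yop s x) =
    \sum_l ((l == s')%:R * sg s l) *: Xop l (Yop s x).
  rewrite [RHS](bigD1 s') //= big1 ?addr0 ?eqxx ?mul1r // => l /negPf ->.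
  by rewrite mul0r scale0r.
have -> : Xop s (Yop s' x) =
    \sum_l (sg s' l * sg s l) *: Xop l (Xop s (eop s' l x)).
  rewrite !Yop.unlock linear_sum; apply: eq_bigr => l _.
  by rewrite linearZ /= XopC scalerA.
rewrite {1}Yop.unlock scaler_sumr -big_split -sumrB; apply: eq_bigr => l _ /=.
rewrite eYop !(linearD, linearN, linearZ) /= /sg /epar.
move: (ipar s) (ipar s') (ipar l).
by do 3!case; rewrite /=; lmod_ring K (FaL L).
Qed.

(** * Identification of these operators with the summands of the action *)

Lemma extend_linEw (g : expo m n -> Fa) (f : Fa) (d : {fset expo m n}) :
  (msupp f `<=` d)%fset -> extend_lin g f = \sum_(k <- d) mcoeff k f *: g k.
Proof.
move=> fd; rewrite /extend_lin (big_fset_incl _ fd) //= => k _ kf.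
by rewrite mcoeff_outdom ?scale0r.
Qed.

Lemma extend_linZ (g : expo m n -> Fa) c (f : Fa) :
  extend_lin g (c *: f : Fa) = c *: extend_lin g f.
Proof.
rewrite (extend_linEw g (msuppZ_le c f)) /extend_lin scaler_sumr.
by apply: eq_bigr => k _; rewrite mcoeffZ scalerA.
Qed.

Lemma extend_lin0 (g : expo m n -> Fa) : extend_lin g (0 : Fa) = 0.
Proof. by rewrite /extend_lin msupp0 big_seq_fset0. Qed.

Lemma extend_lin_mono (g : expo m n -> Fa) k : extend_lin g (mono K k) = g k.
Proof.
rewrite (extend_linEw g (msuppU_le (k := k))) big_seq_fset1 mcoeffUU.
by rewrite scale1r.
Qed.

Lemma pure0 (u : L) : pure (0 : Fa) u = 0.
Proof. by rewrite /pure msupp0 big_seq_fset0. Qed.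

Lemma pureZ_mono c (k : expo m n) (u : L) :
  pure (c *: mono K k) u = c *: embed k u.
Proof.
have ck : (msupp (c *: mono K k) `<=` [fset k])%fset.
  exact: fsubset_trans (msuppZ_le _ _) msuppU_le.
rewrite -linearZ /= /pure (big_fset_incl _ ck) /=.
  rewrite big_seq_fset1 mcoeffZ mcoeffUU mulr1.
  by rewrite embed.unlock.
move=> k' _ k'N; rewrite mcoeff_outdom // scale0r; exact: monalgU0.
Qed.

Lemma pure_mono (k : expo m n) (u : L) : pure (mono K k) u = embed k u.
Proof. by rewrite -[mono K k]scale1r pureZ_mono scale1r. Qed.

Lemma pure_insub c (k : expt) (u : L) :
  pure (if insub k is Some k' then c *: mono K (k' : expo m n) else 0) u
  = c *: tmon k u.
Proof.
rewrite tmon.unlock; case: insub => [k'|]; first exact: pureZ_mono.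
by rewrite pure0 scaler0.
Qed.

Lemma t_over_t0_mono (i : I) (k : expo m n) :
  t_over_t0 (lift ord0 i) (mono K k) =
  if insub (addx (val k) i) is Some k' then
    ksign i (val k) *: mono K (k' : expo m n) else 0.
Proof. by rewrite /t_over_t0 extend_lin_mono liftK. Qed.

Lemma t0_d_mono a (i : I) (k : expo m n) : t0_d a (lift ord0 i) (mono K k) =
  if insub (subx (val k) i) is Some k' then
    (ksign i (val k) * (val k i)%:R) *: mono K (k' : expo m n) else 0.
Proof. by rewrite /t0_d extend_lin_mono liftK. Qed.

Lemma t0_d0_mono a (k : expo m n) :
  t0_d a ord0 (mono K k) = (a - (expo_sum k)%:R) *: mono K k.
Proof. by rewrite /t0_d extend_lin_mono unlift_none. Qed.

(** The exponent of an odd variable is [0] or [1], where parity and value agree. *)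
Lemma dcoef_expo (i : I) (k : expo m n) : dcoef i (val k) = (val k i)%:R.
Proof.
rewrite /dcoef; case ib: ipar => //.
have /forallP /(_ i) := valP k; rewrite ib /=.
by case: (val k i) => [|[|]].
Qed.

Lemma tens_t_over_t0 (i s t : I) (x : F) :
  tens (t_over_t0 (lift ord0 i)) (epar s t) (glact s t) x = Xop i (eop s t x).
Proof.
rewrite eop.unlock fext.unlock linear_sum; apply: eq_bigr => k _.
by rewrite t_over_t0_mono pure_insub !linearZ /= Xop_embed !scalerA mulrC.
Qed.

Lemma tens_id (s t : I) (x : F) : tens id (epar s t) (glact s t) x = eop s t x.
Proof.
rewrite eop.unlock fext.unlock; apply: eq_bigr => k _.
by rewrite pure_mono linearZ.
Qed.

Lemma tens_t0_d a (i : I) (x : F) :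
  tens (t0_d a (lift ord0 i)) false id x = Dop i x.
Proof.
rewrite Dop.unlock fext.unlock; apply: eq_bigr => k _.
by rewrite t0_d_mono pure_insub scale1r dcoef_expo.
Qed.

Lemma tens_t0_d0 a (x : F) : tens (t0_d a ord0) false id x = Eop a x.
Proof.
rewrite Eop.unlock fext.unlock; apply: eq_bigr => k _.
by rewrite t0_d0_mono pureZ_mono scale1r.
Qed.

Lemma tens_t_d a (i j : I) (x : F) :
  tens (t_d a (lift ord0 i) (lift ord0 j)) false id x = Xop i (Dop j x).
Proof.
rewrite Dop.unlock fext.unlock linear_sum; apply: eq_bigr => k _.
rewrite /t_d /= t0_d_mono scale1r linearZ /= tmon.unlock dcoef_expo.
case: insub => [k'|]; last first.
  by rewrite /t_over_t0 extend_lin0 pure0 linear0 scaler0.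
rewrite Xop_embed /t_over_t0 extend_linZ -/(t_over_t0 _) t_over_t0_mono.
rewrite tmon.unlock; case: insub => [k''|]; last by rewrite !scaler0 pure0.
by rewrite !scalerA pureZ_mono.
Qed.

Lemma tens_t_d0 a (i : I) (x : F) :
  tens (t_d a (lift ord0 i) ord0) false id x = Xop i (Eop a x).
Proof.
rewrite Eop.unlock fext.unlock linear_sum; apply: eq_bigr => k _.
rewrite /t_d /= t0_d0_mono scale1r linearZ /=.
rewrite Xop_embed /t_over_t0 extend_linZ -/(t_over_t0 _) t_over_t0_mono.
rewrite tmon.unlock; case: insub => [k''|]; last by rewrite !scaler0 pure0.
by rewrite !scalerA pureZ_mono.
Qed.

(** * The graded module structure on [F_a (x) L] *)

Variables (a r : K) (R : {poly Ugl K m n}).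
Hypothesis R_scalar : forall x : F, R_act a R x = r *: x.

(* The action for R = 0 *)
Definition phi0 (i j : 'I_(m + n).+1) (x : F) : F :=
  match unlift ord0 i, unlift ord0 j with
  | Some s, Some t => Xop s (Dop t x) + eop s t x
  | Some s, None => Xop s (Eop a x) - Yop s x
  | None, Some t => Dop t x
  | None, None => Eop a x
  end.

(** The value at [e_ij] of [r] times the supertrace. *)
Definition phi_shift (i j : 'I_(m + n).+1) : K :=
  (i == j)%:R * (-1) ^+ @ipar m.+1 n i * r.

Lemma phi_actE (i j : 'I_(m + n).+1) (x : F) :
  phi_act a R i j x = phi0 i j x + phi_shift i j *: x.
Proof.
have lift_neq0 (s : I) : (lift ord0 s == ord0) = false by [].
have neq0_lift (s : I) : (ord0 == lift ord0 s) = false by [].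
rewrite /phi_act /phi0 /phi_shift.
case: (unliftP ord0 i) => [s ->|->]; case: (unliftP ord0 j) => [t ->|->].
- rewrite tens_t_d tens_id (inj_eq lift_inj); congr (_ + _).
  case: eqP => [<-|_]; last by rewrite 2!mul0r scale0r.
  by rewrite R_scalar scalerA mul1r andbb.
- rewrite -> (tens_t_d0 a s x); rewrite lift_neq0 2!mul0r scale0r addr0.
  congr (_ - _).
  by rewrite Yop.unlock; apply: eq_bigr => l _; rewrite tens_t_over_t0.
- by rewrite neq0_lift tens_t0_d 2!mul0r scale0r addr0.
- by rewrite eqxx tens_t0_d0 R_scalar mul1r expr0 mul1r.
Qed.

Lemma phi0_is_linear i j : linear (phi0 i j).
Proof.
move=> c x y; rewrite /phi0; do 2!case: unlift => [?|];
  rewrite !linearP /=; lmod_ring K (FaL L).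
Qed.

Lemma phi0_bracket (i j k l : 'I_(m + n).+1) (x : F) :
    let s : K := (-1) ^+ (@epar m.+1 n i j && @epar m.+1 n k l) in
    phi0 i j (phi0 k l x) - s *: phi0 k l (phi0 i j x)
    = (j == k)%:R *: phi0 i l x - (s * (i == l)%:R) *: phi0 k j x.
Proof.
have lift_eqS (s t : I) : (lift ord0 s == lift ord0 t) = (s == t).
  exact: (inj_eq (@lift_inj _ ord0)).
have lift_neq0 (s : I) : (lift ord0 s == ord0) = false by [].
have neq0_lift (s : I) : (ord0 == lift ord0 s) = false by [].
have iparS (s : I) : @ipar m.+1 n (lift ord0 s) = ipar s by [].
have ipar0 : @ipar m.+1 n ord0 = false by [].
pose iparE := (iparS, ipar0).
(* Linearity is restated for each operator so that it can join the commutation relations in one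
   multirule. *)
have lin (f : {linear F -> F}) :
  ((forall y z : F, f (y + z)%R = (f y + f z)%R)
   * ((forall y : F, f (- y)%R = (- f y)%R)
   * (forall c (y : F), f (c *: y)%R = (c *: f y)%R)))%type.
  by split; [move=> y z|split=> [y|c y]]; rewrite (linearD, linearN, linearZ).
have XL i0 := lin (Xop i0); have DL i0 := lin (Dop i0); have EL := lin (Eop a).
have eL i0 j0 := lin (eop i0 j0); have YL i0 := lin (Yop i0).
rewrite /= in XL DL EL eL YL.
pose rules := (XL, DL, EL, eL, YL, DXop, EXop, EDop, eXop, eDop, eEop,
  YXop, DYop, EYop, eYop).
cbv zeta; rewrite /phi0 /epar.
case: (unliftP ord0 i) => [s|] ->; case: (unliftP ord0 j) => [t|] ->;
case: (unliftP ord0 k) => [s'|] ->; case: (unliftP ord0 l) => [t'|] ->;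
  rewrite !iparE ?lift_eqS ?lift_neq0 ?neq0_lift ?eqxx /=;
  rewrite ?(addbF, addFb, andbF);
  rewrite ?rules ?expr0.
(* Both sides are now words in the order X, Y, D, E, e; it remains to sort the
   repeated letters. *)
all: try by lmod_ring K (FaL L).
all: try rewrite (XopC s s'); try rewrite (DopC t t').
all: try rewrite (YopC s s'); try rewrite (eopC s t s' t').
all: rewrite ?rules; try rewrite (XopC s s').
all: rewrite ?rules /sg /epar; try rewrite [t' == s]eq_sym.
all: try case: (eqVneq t s') => [->|_]; try case: (eqVneq s t') => [->|_].
all: do ?case: (ipar _) => /=.
all: by lmod_ring K (FaL L).
Qed.

Local Notation V := (FaL_rep L a R).

Lemma FaL_bracket (i j k l : 'I_(m + n).+1) (x : F) :
    let s : K := (-1) ^+ (@epar m.+1 n i j && @epar m.+1 n k l) in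
    phi_act a R i j (phi_act a R k l x)
    - s *: phi_act a R k l (phi_act a R i j x)
    = (j == k)%:R *: phi_act a R i l x - (s * (i == l)%:R) *: phi_act a R k j x.
Proof.
cbv zeta; have := phi0_bracket i j k l x; cbv zeta.
set s : K := (-1) ^+ _ => /eqP; rewrite subr_eq => /eqP br.
(* The shift is nonzero only for [i = j]; then [e_ij] is even and [s = 1]. *)
have s_ij : s * phi_shift i j = phi_shift i j.
  rewrite /phi_shift /s; case: eqP => [<-|_]; last by rewrite !mul0r mulr0.
  by rewrite /epar addbb mul1r.
have s_kl : s * phi_shift k l = phi_shift k l.
  rewrite /phi_shift /s; case: eqP => [<-|_]; last by rewrite !mul0r mulr0.
  by rewrite /epar addbb andbF mul1r.
(* The supertrace of the bracket of [e_ij] and [e_kl] is zero. *)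
have s_il : (j == k)%:R * phi_shift i l = s * (i == l)%:R * phi_shift k j.
  rewrite /phi_shift /s [k == j]eq_sym.
  have [<-|_] := eqVneq j k; have [<-|_] := eqVneq i l;
    rewrite ?mul0r ?mulr0 ?mul0r //.
  rewrite /epar; case: (@ipar m.+1 n i); case: (@ipar m.+1 n j);
    rewrite /=; ring.
have phi0P i' j' c (y z : F) :
    phi0 i' j' (y + c *: z) = phi0 i' j' y + c *: phi0 i' j' z.
  by rewrite addrC phi0_is_linear addrC.
rewrite !phi_actE !phi0P br.
transitivity (phi_shift i j *: (phi0 k l x + phi_shift k l *: x)
  + phi_shift k l *: phi0 i j x
  + ((j == k)%:R *: phi0 i l x - (s * (i == l)%:R) *: phi0 k j x)
  - ((s * phi_shift i j) *: (phi0 k l x + phi_shift k l *: x)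
     + (s * phi_shift k l) *: phi0 i j x)); first by lmod_ring K (FaL L).
rewrite s_ij s_kl.
transitivity ((j == k)%:R *: phi0 i l x + ((j == k)%:R * phi_shift i l) *: x
  - ((s * (i == l)%:R) *: phi0 k j x
     + (s * (i == l)%:R * phi_shift k j) *: x)); last by lmod_ring K (FaL L).
by rewrite s_il; lmod_ring K (FaL L).
Qed.

Lemma FaL_hom0 b : FaL_hom b (0 : F).
Proof.
by move=> k; rewrite -[mcoeff k _]/(coef k 0) linear0; apply: glmod_hom0.
Qed.

Lemma FaL_homP b c (x y : F) :
  FaL_hom b x -> FaL_hom b y -> FaL_hom b (c *: x + y).
Proof.
move=> xb yb k; rewrite -[mcoeff k _]/(coef k _) linearP /=.
by apply: glmod_homP.
Qed.

Lemma FaL_homZ b c (x : F) : FaL_hom b x -> FaL_hom b (c *: x).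
Proof. by move=> xb; rewrite -[_ *: _]addr0; apply/FaL_homP/FaL_hom0. Qed.

Lemma FaL_homD b (x y : F) : FaL_hom b x -> FaL_hom b y -> FaL_hom b (x + y).
Proof. by move=> xb yb; rewrite -[x]scale1r; apply: FaL_homP. Qed.

Lemma FaL_homB b (x y : F) : FaL_hom b x -> FaL_hom b y -> FaL_hom b (x - y).
Proof. by move=> xb yb; rewrite addrC -scaleN1r; apply: FaL_homP. Qed.

Lemma FaL_hom_sum b (J : Type) (s : seq J) (f : J -> F) :
  (forall j, FaL_hom b (f j)) -> FaL_hom b (\sum_(j <- s) f j).
Proof.
by move=> fb; apply: big_ind => // [|x y]; [apply: FaL_hom0|apply: FaL_homD].
Qed.

Lemma FaL_hom_embed b k u :
  glhom (xpar (val k) (+) b) u -> FaL_hom b (embed k u).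
Proof.
move=> ub k'; rewrite -[mcoeff k' _]/(coef k' _) coef_embed.
by case: eqP => [<-//|_]; apply: glmod_hom0.
Qed.

Lemma FaL_hom_tmon b (k : expt) u :
  glhom (xpar k (+) b) u -> FaL_hom b (tmon k u).
Proof.
have [kE|kN] := boolP (is_expo k) => ub; last first.
  by rewrite tmon_not_expo //; apply: FaL_hom0.
by case: (expoP kE) ub => k' ->; rewrite tmon_val; apply: FaL_hom_embed.
Qed.

Lemma FaL_hom_op (f : {linear F -> F}) c b (x : F) :
  (forall k u,
     glhom (xpar (val k) (+) b) u -> FaL_hom (c (+) b) (f (embed k u))) ->
  FaL_hom b x -> FaL_hom (c (+) b) (f x).
Proof.
move=> fb xb; rewrite (FaL_embedE x) linear_sum.
by apply: FaL_hom_sum => k; apply/fb/xb.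
Qed.

Lemma Xop_hom i b (x : F) : FaL_hom b x -> FaL_hom (ipar i (+) b) (Xop i x).
Proof.
apply: FaL_hom_op => k u ub /=; rewrite Xop_embed.
by apply/FaL_homZ/FaL_hom_tmon; rewrite xpar_addx addbACA addbb addFb.
Qed.

Lemma Dop_hom i b (x : F) : FaL_hom b x -> FaL_hom (ipar i (+) b) (Dop i x).
Proof.
apply: FaL_hom_op => k u ub /=; rewrite Dop_embed.
have [k0|k0] := posnP (val k i).
  by rewrite dcoef_eq0 // mulr0 scale0r; apply: FaL_hom0.
apply/FaL_homZ/FaL_hom_tmon; move: ub.
by rewrite -{1}(addx_subx k0) xpar_addx addbCA addbA.
Qed.

Lemma Eop_hom b (x : F) : FaL_hom b x -> FaL_hom b (Eop a x).
Proof.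
rewrite -[b]addFb; apply: FaL_hom_op => k u ub /=; rewrite Eop_embed.
exact/FaL_homZ/FaL_hom_embed.
Qed.

Lemma eop_hom s t b (x : F) :
  FaL_hom b x -> FaL_hom (epar s t (+) b) (eop s t x).
Proof.
apply: FaL_hom_op => k u ub /=; rewrite eop_embed.
by apply/FaL_homZ/FaL_hom_embed; rewrite addbCA; apply: glmod_act_hom.
Qed.

Lemma Yop_hom s b (x : F) : FaL_hom b x -> FaL_hom (ipar s (+) b) (Yop s x).
Proof.
move=> xb; rewrite Yop.unlock; apply: FaL_hom_sum => l; apply: FaL_homZ.
have := Xop_hom l (eop_hom s l xb).
rewrite /epar addbA [ipar l (+) _]addbC -!addbA.
by rewrite [ipar l (+) (_ (+) _)]addbA addbb.
Qed.

Lemma phi_act_hom (i j : 'I_(m + n).+1) b (x : F) :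
  FaL_hom b x -> FaL_hom (@epar m.+1 n i j (+) b) (phi_act a R i j x).
Proof.
move=> xb; rewrite phi_actE; apply: FaL_homD; last first.
  rewrite /phi_shift; case: eqP => [<-|_].
    by rewrite /epar addbb addFb; apply: FaL_homZ.
  by rewrite !mul0r scale0r; apply: FaL_hom0.
rewrite /phi0 /epar.
case: (unliftP ord0 i) => [s ->|->]; case: (unliftP ord0 j) => [t ->|->].
- apply: FaL_homD; last exact: eop_hom.
  by have := Xop_hom s (Dop_hom t xb); rewrite addbA.
- have E : @ipar m.+1 n ord0 = false by [].
  rewrite E addbF; apply: FaL_homB; last exact: Yop_hom.
  exact/Xop_hom/Eop_hom.
- exact: Dop_hom.
- exact: Eop_hom.
Qed.

Lemma FaL_mod : is_glmod V.
Proof.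
split.
- suff phi_lin (i j : 'I_(m + n).+1) : linear (phi_act a R i j : F -> F).
    by move=> i j; exact: phi_lin.
  move=> c x y; rewrite !phi_actE phi0_is_linear; lmod_ring K (FaL L).
- exact: FaL_hom0.
- exact: FaL_homP.
- move=> x; rewrite (FaL_embedE x).
  apply: (big_ind (fun x : F => exists x0 x1 : F,
      [/\ FaL_hom false x0, FaL_hom true x1 & x = x0 + x1])).
  + by exists 0, 0; rewrite addr0; split=> //; apply: FaL_hom0.
  + move=> _ _ [x0 [x1 [h0 h1 ->]]] [y0 [y1 [k0 k1 ->]]].
    exists (x0 + y0), (x1 + y1).
    by rewrite addrACA; split=> //; apply: FaL_homD.
  + move=> k _; have [u0 [u1 [h0 h1 ->]]] := glmod_homD L_mod (coef k x).
    rewrite linearD /=; case kp: (xpar (val k)).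
      by exists (embed k u1), (embed k u0); rewrite addrC; split=> //;
        apply: FaL_hom_embed; rewrite kp.
    by exists (embed k u0), (embed k u1); split=> //;
      apply: FaL_hom_embed; rewrite kp.
- move=> x x0 x1; apply: FaL_eqP => k; rewrite linear0.
  have := x0 k; have := x1 k; rewrite -[mcoeff k _]/(coef k _).
  case: (expo_par k) => /= h1 h0; exact: (glmod_homI L_mod).
- by move=> i j b x; apply: phi_act_hom.
- by move=> i j k l x; apply: FaL_bracket.
Qed.

(** * The subspace [t_0^a (x) L] and simplicity *)

Lemma top_vectorE u : top_vector u = embed (expo0 m n) u.
Proof. exact: pure_mono. Qed.

Lemma Dop_top i u : Dop i (embed (expo0 m n) u) = 0.
Proof. by rewrite Dop_embed dcoef_eq0 ?ffunE // mulr0 scale0r. Qed.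

Lemma phi_act_D0 (t : I) (x : F) : phi_act a R ord0 (lift ord0 t) x = Dop t x.
Proof.
have neq0_lift : (ord0 == lift ord0 t) = false by [].
rewrite phi_actE /phi0 /phi_shift unlift_none liftK neq0_lift.
by rewrite 2!mul0r scale0r addr0.
Qed.

Lemma phi_act_top (s t : I) u :
  phi_act a R (lift ord0 s) (lift ord0 t) (embed (expo0 m n) u)
  = embed (expo0 m n) (glact s t u + ((s == t)%:R * (-1) ^+ ipar s * r) *: u).
Proof.
rewrite phi_actE /phi0 /phi_shift !liftK Dop_top linear0 add0r eop_embed.
have -> : xpar (val (expo0 m n)) = false.
  by rewrite /xpar big1 // => i _; rewrite ffunE.
by rewrite andbF scale1r (inj_eq lift_inj) linearD linearZ.
Qed.

Let mkexpo (k : expt) (kE : is_expo k) : expo m n := exist _ k kE.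

Definition coefx (k : expt) (x : F) : L :=
  if insub k is Some k' then coef (k' : expo m n) x else 0.

Lemma coef_Dop i (k : expo m n) (x : F) : coef k (Dop i x) =
  (ksign i (val k) * dcoef i (addx (val k) i)) *: coefx (addx (val k) i) x.
Proof.
move: x; apply: FaL_ext => [x y|x y|l u].
- by rewrite !linearD.
- by rewrite /coefx; case: insub => [k'|]; rewrite ?linearD ?scaler0 ?addr0.
rewrite Dop_embed linearZ /= /coefx.
have [l0|l0] := posnP (val l i).
  rewrite dcoef_eq0 // mulr0 scale0r; case: insubP => [k' _ k'E|_]; last first.
    by rewrite scaler0.
  rewrite coef_embed; case: eqP => [lk|_]; last by rewrite scaler0.
  by move: l0; rewrite lk k'E !ffunE eqxx addn1.
have lE := addx_subx l0.
have ls : is_expo (subx (val l) i).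
  by apply: (@is_expo_addx _ _ _ i); rewrite lE valP.
rewrite -[subx (val l) i]/(val (mkexpo ls)) tmon_val coef_embed.
have [lk|lk] := eqVneq (mkexpo ls) k.
  have kE : addx (val k) i = val l by rewrite -lk.
  rewrite kE valK coef_embed eqxx; congr (_ * _ *: _).
  by rewrite -kE ksign_addx ltnn andbF mul1r.
rewrite scaler0; case: insubP => [k' _ k'E|_]; last by rewrite scaler0.
rewrite coef_embed; case: eqP => [lk'|_]; last by rewrite scaler0.
case/eqP: lk; apply: val_inj => /=.
by rewrite lk' k'E subx_addx.
Qed.

(** If [k i > 0], a coefficient of [Dop i x] is the coefficient of [x] at [k] times [k i] up to
    sign, and [k i] is nonzero in [K]. *)
Lemma Dop_eq0 (x : F) : (forall i, Dop i x = 0) ->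
  x = embed (expo0 m n) (coef (expo0 m n) x).
Proof.
move=> Dx; apply: FaL_eqP => k; rewrite coef_embed; case: eqP => [->//|k0].
have [i ki] : exists i, (0 < val k i)%N.
  apply/existsP; apply: contra_notT k0; rewrite negb_exists => /forallP kN.
  apply/esym/val_inj/ffunP => i; rewrite ffunE; apply/eqP.
  by have := kN i; rewrite lt0n negbK.
have kE := addx_subx ki.
have ks : is_expo (subx (val k) i).
  by apply: (@is_expo_addx _ _ _ i); rewrite kE valP.
have := coef_Dop i (mkexpo ks) x; rewrite Dx linear0 /= kE.
rewrite /coefx valK => /esym/eqP; rewrite scaler_eq0 mulf_eq0 => /orP[|/eqP//].
have := ksign2 K i (subx (val k) i); set c := ksign _ _ => c2.
have c0 : c != 0.
  by apply/eqP => c0; move: c2; rewrite c0 mul0r => /esym/eqP; rewrite oner_eq0.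
by rewrite (negPf c0) dcoef_expo pnatr_eq0 -leqn0 leqNgt ki.
Qed.

(** Derivations lower the degree by one, so the induction is on a strict bound [d] for the degrees
    occurring in [x]. *)
Lemma submod_top (N : V -> Prop) (x : F) : is_submod N -> N x -> x <> 0 ->
  exists2 u, u <> 0 & N (embed (expo0 m n) u).
Proof.
move=> [_ _ _ Nact].
have [d xd] : exists d, forall k, (d <= expo_sum k)%N -> coef k x = 0.
  exists (\max_(k <- msupp x) expo_sum k).+1 => k kd.
  apply: coef_outdom; apply: contraL kd => kx; rewrite -ltnNge ltnS.
  exact: leq_bigmax_seq kx isT.
elim: d x xd => [|d IH] x xd Nx x0.
  by case: x0; apply: FaL_eqP => k; rewrite xd ?linear0.
have [Dx|Dx] := pselect (forall i, Dop i x = 0).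
  exists (coef (expo0 m n) x); last by rewrite -Dop_eq0.
  by move=> x00; apply: x0; rewrite (Dop_eq0 Dx) x00 linear0.
have [i Dix] : exists i, Dop i x <> 0.
  apply: contrapT => /forallNP Di; apply: Dx => i.
  by apply: contrapT; apply: Di.
apply: IH Dix => [k kd|]; last by rewrite -phi_act_D0; apply: Nact.
rewrite coef_Dop /coefx; case: insubP => [k' _ k'E|_]; last by rewrite scaler0.
by rewrite xd ?scaler0 // /expo_sum k'E sum_addx /= addn1 ltnS.
Qed.

Hypothesis L_simple : is_simple L.

Lemma generated_simple (v : L) : v <> 0 ->
  generated_by (V := V) (top_vector v) -> is_simple V.
Proof.
move=> v0 gen; split.
  exists (top_vector v); rewrite top_vectorE => /(congr1 (coef (expo0 m n))).
  by rewrite coef_embed eqxx linear0.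
move=> N N_sub; have [NV|NV] := pselect (forall x, N x -> x = 0); first by left.
right; have [x [Nx x0]] : exists x, N x /\ x <> 0.
  apply: contrapT => H; apply: NV => x Nx; apply: contrapT => x0; apply: H.
  by exists x.
have [u u0 Nu] := submod_top N_sub Nx x0.
have [NT0 NP Nhom Nact] := N_sub.
have NL_sub : is_submod (fun u => N (embed (expo0 m n) u)).
  split.
  - by rewrite linear0.
  - by move=> c y z Ny Nz; rewrite linearP; apply: NP.
  - move=> y z yh zh; rewrite linearD; apply: Nhom; apply: FaL_hom_embed;
      by rewrite /xpar big1 // => i _; rewrite ffunE.
  - move=> s t y Ny; have := Nact (lift ord0 s) (lift ord0 t) _ Ny.
    rewrite [glact _ _ _]phi_act_top => Ny'.
    (* The scalar twist is a multiple of a vector already in [N]; removing it leaves the action on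
       [L]. *)
    have := NP (- ((s == t)%:R * (-1) ^+ ipar s * r)) _ _ Ny Ny'.
    rewrite -linearZ -linearD /=; congr (N (embed _ _)); lmod_ring K L.
have [NL0|NLT] := proj2 L_simple _ NL_sub; first by case: u0; apply: NL0.
by apply: gen N_sub _; rewrite top_vectorE; apply: NLT.
Qed.

Lemma top_hwv lam (v : L) : is_hwv lam v ->
  is_hwv (V := V) (lam_tilde a r lam) (top_vector v).
Proof.
case=> v0 v_up v_wt; rewrite top_vectorE; split.
- move=> /(congr1 (coef (expo0 m n))).
  by rewrite coef_embed eqxx linear0.
- suff up (i j : 'I_(m + n).+1) : (i < j)%N ->
      phi_act a R i j (embed (expo0 m n) v) = 0.
    by move=> i j; exact: up.
  case: (unliftP ord0 j) => [t ->|-> //]; case: (unliftP ord0 i) => [s ->|-> _].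
    rewrite /= ltnS => st; rewrite phi_act_top v_up // -val_eqE ltn_eqF //.
    by rewrite mul0r mul0r scale0r addr0 linear0.
  by rewrite phi_act_D0 Dop_top.
- suff wt (i : 'I_(m + n).+1) : phi_act a R i i (embed (expo0 m n) v)
      = lam_tilde a r lam i *: embed (expo0 m n) v.
    by move=> i; exact: wt.
  rewrite /lam_tilde; case: (unliftP ord0 i) => [s ->|->].
    rewrite phi_act_top v_wt eqxx -scalerDl linearZ; congr (_ *: _).
    by case: (ipar s) => /=; ring.
  rewrite phi_actE /phi0 /phi_shift unlift_none eqxx Eop_embed -scalerDl.
  rewrite /expo_sum big1 => [|j _]; last by rewrite ffunE.
  congr (_ *: _); rewrite /=; ring.
Qed.

Lemma top_hom b (v : L) : glhom b v -> FaL_hom b (top_vector v).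
Proof.
move=> vb; rewrite top_vectorE; apply: FaL_hom_embed.
by rewrite /xpar big1 // => i _; rewrite ffunE.
Qed.

End TensorOperators.

(** * Transfer of simplicity and the equivalence *)

Lemma simple_generated (K : numFieldType) (p q : nat)
    (V : glrep K p q) (v : V) :
  is_simple V -> v <> 0 -> generated_by v.
Proof.
move=> [_ V_simple] v0 N N_sub Nv.
by have [N0|] := V_simple N N_sub; first by case: v0; apply: N0.
Qed.

Lemma simple_iso (K : numFieldType) (p q : nat) (V W : glrep K p q) :
  is_glmod V -> is_glmod W -> gl_iso V W -> is_simple W -> is_simple V.
Proof.
move=> Vm Wm [f [[g fK gK] f_hom f_act]] [[y y0] W_simple]; split.
  exists (g y) => gy0; apply: y0; by rewrite -[y]gK gy0 linear0.
move=> N [N0 NP Nhom Nact].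
have fN_sub : is_submod (fun y => N (g y)).
  have gP c x z : g (c *: x + z) = c *: g x + g z.
    by apply: (can_inj fK); rewrite linearP /= !gK.
  split.
  - by rewrite -[0](linear0 f) fK.
  - by move=> c x z Nx Nz; rewrite gP; apply: NP.
  - move=> y0' y1 h0 h1 Ny.
    (* That [g] preserves parity has to be derived: [f] sends the parity components of
       [g (y0' + y1)] to components of [y0' + y1], and these are unique in [W]. *)
    have [x0 [x1 [x0h x1h xE]]] := glmod_homD Vm (g (y0' + y1)).
    have E : f x0 + f x1 = y0' + y1 by rewrite -linearD -xE gK.
    have [<- <-] := glhom_unique Wm (f_hom _ _ x0h) (f_hom _ _ x1h) h0 h1 E.
    by rewrite !fK; apply: Nhom => //; rewrite -xE.
  - move=> i j x Nx; suff -> : g (glact i j x) = glact i j (g x) by apply: Nact.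
    by apply: (can_inj fK); rewrite f_act !gK.
have [H|H] := W_simple _ fN_sub.
  left=> x Nx; apply: (can_inj fK); rewrite linear0; apply: H.
  by rewrite fK.
by right=> x; rewrite -[x]fK; apply: H.
Qed.

Theorem theorem4p3 (Re : realType) (m n : nat) (a : Re[i])
    (R : {poly Ugl Re[i] m n}) (R_center : forall k : nat, in_Zgl R`_k)
    (lam : 'I_(m + n) -> Re[i]) (b : bool)
    (L : glrep Re[i] m n) (v : L) (L_lam : is_L lam b v)
    (r : Re[i]) (R_scalar : forall x : FaL L, R_act a R x = r *: x)
    (Lt : glrep Re[i] m.+1 n) (w : Lt)
    (Lt_lam : is_L (lam_tilde a r lam) b w) :
  gl_iso (FaL_rep L a R) Lt <->
  generated_by (V := FaL_rep L a R) (top_vector v).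
Proof.
have [L_mod L_simple v_hw v_hom] := L_lam.
have [Lt_mod Lt_simple _ _] := Lt_lam.
have V_mod := FaL_mod L_mod R_scalar.
have V_hw := top_hwv L_mod R_scalar v_hw.
split=> [iso|gen].
  apply: simple_generated; last by case: V_hw.
  exact: simple_iso V_mod Lt_mod iso Lt_simple.
apply: simple_hw_iso Lt_lam; split; first exact: V_mod.
- apply: (generated_simple L_mod R_scalar L_simple _ gen).
  by case: v_hw.
- exact: V_hw.
- exact: (top_hom L_mod).
Qed.
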